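(* For $(X,P)\in\mathcal{M}$ and $(\dot X,\dot P)\in\mathrm{T}_{(X,P)}\mathcal{M}$ represented by $(U,\Sigma,V)$ and $(K,V_p)$, define $Z=V+V_p\big(I_r-K^\top U\Sigma S(\alpha)^{-1}\big)$, where $S(\alpha)=2\alpha I_r+\Sigma^2$, and the map $$\mathrm{R}_{(X,P)}(\dot X,\dot P)=\big((X+\dot X)QQ^\top,\ I-QQ^\top\big)\qquad\text{where}\qquad Q=Z(Z^\top Z)^{-1/2}.$$ Then $\mathrm{R}\colon\mathrm{T}\mathcal{M}\to\mathcal{M}$ is a second-order retraction.
   Context: Let $m,n,r$ be positive integers with $r<\min(m,n)$. $\mathrm{Sym}(n)$: real symmetric $n\times n$ matrices; $\mathrm{St}(n,r)=\{V\in\mathbb{R}^{n\times r}:V^\top V=I_r\}$; $\mathrm{Gr}(n,n-r)=\{P\in\mathrm{Sym}(n):P^2=P,\ \mathrm{rank}\,P=n-r\}$. The desingularization $\mathcal{M}=\{(X,P)\in\mathbb{R}^{m\times n}\times\mathrm{Gr}(n,n-r):XP=0\}$ is a smooth embedded submanifold of $\mathcal{E}=\mathbb{R}^{m\times n}\times\mathrm{Sym}(n)$ of dimension $(m+n-r)r$. A representation of $(X,P)\in\mathcal{M}$ is a triplet $(U,\Sigma,V)$ with $U\in\mathrm{St}(m,r)$, $V\in\mathrm{St}(n,r)$, $\Sigma\in\mathbb{R}^{r\times r}$ diagonal with nonnegative, non-increasing diagonal entries, such that $X=U\Sigma V^\top$ and $P=I-VV^\top$ (one always exists). Given it, a representation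 of $(\dot X,\dot P)\in\mathrm{T}_{(X,P)}\mathcal{M}$ is the (unique) pair $(K,V_p)\in\mathbb{R}^{m\times r}\times\mathbb{R}^{n\times r}$ with $V_p^\top V=0$, $\dot X=KV^\top+U\Sigma V_p^\top$, $\dot P=-V_pV^\top-VV_p^\top$; all tangent vectors, and only they, are of this form. $\mathcal{M}$ is a Riemannian submanifold of $\mathcal{E}$ with inner product $\langle(Y_1,Z_1),(Y_2,Z_2)\rangle=\langle Y_1,Y_2\rangle+\alpha\langle Z_1,Z_2\rangle$, $\alpha>0$ fixed (Frobenius inner products on the right). A retraction on $\mathcal{M}$ is a smooth map $\mathrm{R}\colon\mathrm{T}\mathcal{M}\to\mathcal{M}$ such that each curve $c(t)=\mathrm{R}_{(X,P)}(t\dot X,t\dot P)$ satisfies $c(0)=(X,P)$ and $c'(0)=(\dot X,\dot P)$. It is second-order if moreover each such curve has zero initial intrinsic (Riemannian) acceleration, $c''(0)=0$, where $c''(t)$ is the orthogonal projection onto $\mathrm{T}_{c(t)}\mathcal{M}$ of the ordinary acceleration $\ddot c(t)$ of $c$ in $\mathcal{E}$. *)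

(* Defs.v *)
From HB Require Import structures.
From mathcomp Require Import all_boot all_order all_algebra.
From mathcomp Require Import all_classical all_reals all_analysis.

Set Implicit Arguments.
Unset Strict Implicit.
Unset Printing Implicit Defensive.

Import Order.TTheory GRing.Theory Num.Theory.
Import numFieldNormedType.Exports.

Local Open Scope classical_set_scope.
Local Open Scope ring_scope.

(* f is of class C^k on the open set A.  In the finite-dimensional spaces
   considered here, a differentiable f is C^(k+1) iff each of its directional
   derivatives x |-> 'd f x v is C^k. *)
Fixpoint Ck_on (R : realType) (V W : normedModType R) (k : nat) (A : set V)
    (f : V -> W) : Prop :=
  match k with
  | 0%N => forall x, A x -> {for x, continuous f}
  | k'.+1 => (forall x, A x -> differentiable f x) /\
             (forall v : V, Ck_on k' A (fun x => 'D_v f x))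
  end.

Definition smooth_on (R : realType) (V W : normedModType R) (A : set V)
    (f : V -> W) : Prop :=
  forall k, Ck_on k A f.

(* Smoothness of f : A -> B for embedded submanifolds A, B of linear spaces:
   f locally extends to a smooth map between the ambient spaces. *)
Definition smooth_map (R : realType) (V W : normedModType R)
    (A : set V) (B : set W) (f : V -> W) : Prop :=
  (forall x, A x -> B (f x)) /\
  forall x, A x -> exists (O : set V) (g : V -> W),
    [/\ open O, O x, smooth_on O g & forall y, A y -> O y -> g y = f y].

(* The tangent space at x of a submanifold A: the set of velocities at 0 of
   smooth curves on A passing through x at time 0. *)
Definition tangent_space (R : realType) (V : normedModType R) (A : set V)
    (x : V) : set V :=
  [set v | exists (e : R) (c : R^o -> V),
     [/\ 0 < e, smooth_on (`]- e, e[ : set R^o) c,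
         forall t, t \in `]- e, e[ -> A (c t),
         c 0 = x & is_derive (0 : R^o) 1 c v]].

Definition tangent_bundle (R : realType) (V : normedModType R) (A : set V) :
    set (V * V) :=
  [set z | A z.1 /\ tangent_space A z.1 z.2].

Definition retraction (R : realType) (V : normedModType R) (A : set V)
    (rho : V * V -> V) : Prop :=
  smooth_map (tangent_bundle A) A rho /\
  forall x v, tangent_bundle A (x, v) ->
    let c := fun t : R^o => rho (x, t *: v) in
    c 0 = x /\ is_derive (0 : R^o) 1 c v.

Definition is_orthogonal_projection (R : realType) (V : normedModType R)
    (ip : V -> V -> R) (T : set V) (z w : V) : Prop :=
  T w /\ forall u, T u -> ip (z - w) u = 0.

(* w is the intrinsic acceleration at time t of the curve c on A: the
   ip-orthogonal projection of the ordinary acceleration a onto the tangent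
   space. *)
Definition intrinsic_acceleration (R : realType) (V : normedModType R)
    (ip : V -> V -> R) (A : set V) (c : R^o -> V) (t : R^o) (w : V) : Prop :=
  exists a : V, is_derive t 1 (derive1 c) a /\
    is_orthogonal_projection ip (tangent_space A (c t)) a w.

Definition second_order_retraction (R : realType) (V : normedModType R)
    (ip : V -> V -> R) (A : set V) (rho : V * V -> V) : Prop :=
  retraction A rho /\
  forall x v, tangent_bundle A (x, v) ->
    intrinsic_acceleration ip A (fun t : R^o => rho (x, t *: v)) 0 0.

(* The symmetry constraint on the second component is carried by
   Grassmann rather than by the ambient type. *)
Definition ambient (R : realType) (m n : nat) : normedModType R :=
  ('M[R]_(m, n) * 'M[R]_n)%type.

Definition frob (R : realType) (m n : nat) (A B : 'M[R]_(m, n)) : R :=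
  \tr (A^T *m B).

Definition ambient_ip (R : realType) (m n : nat) (alpha : R)
    (y z : ambient R m n) : R :=
  frob y.1 z.1 + alpha * frob y.2 z.2.

Definition Stiefel (R : realType) (n r : nat) : set 'M[R]_(n, r) :=
  [set V | V^T *m V = 1%:M].

Definition Grassmann (R : realType) (n k : nat) : set 'M[R]_n :=
  [set P | [/\ P^T = P, P *m P = P & \rank P = k]].

Definition desing (R : realType) (m n r : nat) : set (ambient R m n) :=
  [set x | Grassmann (n - r) x.2 /\ x.1 *m x.2 = 0].

Arguments ambient_ip : clear implicits.
Arguments desing : clear implicits.

Definition point_repr (R : realType) (m n r : nat) (x : ambient R m n)
    (U : 'M[R]_(m, r)) (S : 'M[R]_r) (V : 'M[R]_(n, r)) : Prop :=
  [/\ Stiefel U, Stiefel V,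
      [/\ is_diag_mx S, forall i, 0 <= S i i &
          forall i j : 'I_r, (i <= j)%N -> S j j <= S i i],
      x.1 = U *m S *m V^T & x.2 = 1%:M - V *m V^T].

Definition tangent_repr (R : realType) (m n r : nat) (v : ambient R m n)
    (U : 'M[R]_(m, r)) (S : 'M[R]_r) (V : 'M[R]_(n, r))
    (K : 'M[R]_(m, r)) (Vp : 'M[R]_(n, r)) : Prop :=
  [/\ Vp^T *m V = 0,
      v.1 = K *m V^T + U *m S *m Vp^T &
      v.2 = - (Vp *m V^T) - V *m Vp^T].

Definition posdefmx (R : realType) (r : nat) (B : 'M[R]_r) : Prop :=
  B^T = B /\ forall x : 'cV[R]_r, x != 0 -> 0 < (x^T *m B *m x) 0 0.

(* A^(-1/2) for a positive definite A: the unique positive definite B with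
   B^2 = A^(-1); the default value 0 is irrelevant in that case. *)
Definition invsqrtmx (R : realType) (r : nat) (A : 'M[R]_r) : 'M[R]_r :=
  xget 0 [set B | [/\ A \in unitmx, posdefmx B & B *m B = invmx A]].

Definition retr_Z (R : realType) (m n r : nat) (alpha : R)
    (U : 'M[R]_(m, r)) (S : 'M[R]_r) (V : 'M[R]_(n, r))
    (K : 'M[R]_(m, r)) (Vp : 'M[R]_(n, r)) : 'M[R]_(n, r) :=
  let Salpha := (2 * alpha)%:M + S *m S in
  V + Vp *m (1%:M - K^T *m U *m S *m invmx Salpha).

Definition retr_formula (R : realType) (m n r : nat) (alpha : R)
    (x v : ambient R m n)
    (U : 'M[R]_(m, r)) (S : 'M[R]_r) (V : 'M[R]_(n, r))
    (K : 'M[R]_(m, r)) (Vp : 'M[R]_(n, r)) : ambient R m n :=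
  let Z := retr_Z alpha U S V K Vp in
  let Q := Z *m invsqrtmx (Z^T *m Z) in
  ((x.1 + v.1) *m Q *m Q^T, 1%:M - Q *m Q^T).

(* The map sends (x, v) to the value of the formula at some representation of
   (x, v); the default value only matters off the tangent bundle, where no
   representation exists.  Independence of the chosen representation has to be
   proved. *)
Definition desing_retr (R : realType) (m n r : nat) (alpha : R)
    (z : ambient R m n * ambient R m n) : ambient R m n :=
  xget z.1 [set y | exists (U : 'M[R]_(m, r)) (S : 'M[R]_r) (V : 'M[R]_(n, r))
                           (K : 'M[R]_(m, r)) (Vp : 'M[R]_(n, r)),
    [/\ point_repr z.1 U S V, tangent_repr z.2 U S V K Vp &
        y = retr_formula alpha z.1 z.2 U S V K Vp]].

Arguments desing_retr : clear implicits.

(* Main.v *)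
(* Everything is read off the projector Pi = Q Q^T onto the range of Z.  Since
   V^T Z = 1, Z has full rank, and W = Z V^T can be written in terms of X, P,
   dX, dP alone:
     W = (1 - P) - P dP + P dP (dX (1 - P))^T X (2 alpha + X^T X)^-1 (1 - P),
     Pi = W (P + W^T W)^-1 W^T.
   Hence the value does not depend on the representation, and the map extends
   to a rational map on the open set where P + W^T W is invertible.
   Representations exist by the singular value decomposition of X V, where V
   is an orthonormal basis of ker P.
   Along t |-> R(t dX, t dP), with M = K^T U S S(alpha)^-1,
     Z = V + t Vp - t^2 Vp M   and   (Z^T Z)^-1 = 1 - t^2 Vp^T Vp + O(t^3),
   so the second order coefficient of the curve is
     ((K - U S M^T) Vp^T, - Pi2),   V^T Pi2 = - (Vp M)^T - Vp^T Vp V^T.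
   Its inner product with the tangent vector given by (K', Vp') is
     tr ((K^T U S - M (2 alpha + S^2)) Vp'^T Vp),
   which vanishes by the choice of M. *)
Require Import Defs.
From HB Require Import structures.
From mathcomp Require Import all_boot all_order all_algebra.
From mathcomp Require Import all_classical all_reals all_analysis.
From mathcomp Require Import ring lra.
Import Order.TTheory GRing.Theory Num.Theory.
Import numFieldNormedType.Exports.
Local Open Scope classical_set_scope.
Local Open Scope ring_scope.
Set Implicit Arguments.
Unset Strict Implicit.
Unset Printing Implicit Defensive.

(** * Calculus of the classes C^k on an open set *)

Lemma near_eq_differentiable (R : realType) (V W : normedModType R)
    (f g : V -> W) (x : V) :
  {near x, f =1 g} -> differentiable f x -> differentiable g x.
Proof.
move=> fg df; have dfc : continuous ('d f x) by exact: diff_continuous.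
have fgx : f x = g x by exact: nbhs_singleton fg.
(* The differential of [f] gives a first-order expansion of [g]; [diff_unique] then identifies it
   with ['d g x]. *)
have gE : g \o shift x = cst (g x) + 'd f x +o_ 0 id.
  apply/eqaddoP => _/posnumP[e].
  have /eqaddoP/(_ e%:num) := diff_locally df; move=> /(_ (gt0 _)) H.
  move: fg; rewrite (near_shift 0 x) subr0 => fg.
  near=> h; have /= fgh : f (h + x) = g (h + x) by near: h.
  by rewrite !fctE/= -fgh -fgx; near: h; exact: H.
by apply/diff_locallyP; rewrite (diff_unique dfc gE).
Unshelve. all: by end_near. Qed.

Section ScaleBilinear.
Context {R : realType} (W : normedModType R).

Let scale_is_bilinear : bilinear_for
  (GRing.Scale.Law.clone _ _ *:%R _) (GRing.Scale.Law.clone _ _ *:%R _)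
  (@GRing.scale R W).
Proof.
split=> [w|c] a x y /=; first by rewrite scalerDl scalerA.
by rewrite scalerDr !scalerA mulrC.
Qed.
HB.instance Definition _ := bilinear_isBilinear.Build R R W W _ _
  (@GRing.scale R W) scale_is_bilinear.

(** Scaling is a continuous bilinear map on [R * W], so the product rule is the chain rule through
    the pair [(f y, g y)]. *)
Lemma is_diff_scale_fun (V : normedModType R) (f : V -> R) (g : V -> W) x :
  differentiable f x -> differentiable g x ->
  is_diff x (fun y => f y *: g y) (fun v => f x *: 'd g x v + 'd f x v *: g x).
Proof.
have sc : continuous (fun p : R * W => p.1 *: p.2).
  by move=> p; exact: scale_continuous.
move=> df dg; pose h y := (f y, g y).
have dh : differentiable h x by exact: differentiable_pair.
have ds p : differentiable (fun p : R * W => p.1 *: p.2) p.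
  exact: differentiable_bilin.
have -> : (fun y => f y *: g y) = (fun p => p.1 *: p.2) \o h by [].
apply: DiffDef; first exact: differentiable_comp.
by rewrite diff_comp// diff_bilin// diff_pair.
Qed.

End ScaleBilinear.

Section SmoothCalculus.
Context {R : realType} {V : normedModType R} (A : set V).
Hypothesis openA : open A.

(** Since [A] is open, equality on [A] is equality near each of its points, which preserves
    derivatives. The closure lemmas below use this to replace a directional derivative by its
    expression from a calculus rule that is only available on [A]. *)
Lemma Ck_on_eq (W : normedModType R) k (f g : V -> W) :
  (forall x, A x -> f x = g x) -> Ck_on k A f -> Ck_on k A g.
Proof.
have nA (W' : normedModType R) (h1 h2 : V -> W') x : A x ->
    (forall y, A y -> h1 y = h2 y) -> {near x, h1 =1 h2}.
  move=> Ax h; have := open_nbhs_nbhs (conj openA Ax).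
  by apply: filterS => y Ay; exact: h.
elim: k W f g => [|k IH] W f g fg /=.
  move=> fc x Ax; rewrite /prop_for /continuous_at -fg//.
  apply: cvg_trans (fc x Ax); apply: near_eq_cvg.
  exact: nA Ax fg.
move=> [fd fD]; split.
  by move=> x Ax; apply: near_eq_differentiable (fd x Ax); exact: nA Ax fg.
move=> v; apply: (IH _ _ _ _ (fD v)) => x Ax.
apply: near_eq_derive; exact: nA Ax fg.
Qed.

Lemma Ck_onS (W : normedModType R) k (f : V -> W) :
  Ck_on k.+1 A f -> Ck_on k A f.
Proof.
elim: k W f => [|k IH] W f [fd fD].
  by move=> x Ax; exact/differentiable_continuous/fd.
by split=> // v; exact: IH.
Qed.

Lemma Ck_on_cst (W : normedModType R) k (w : W) : Ck_on k A (fun=> w).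
Proof.
elim: k W w => [|k IH] W w /=; first by move=> x _; exact: cst_continuous.
split=> [x _|v]; first exact: differentiable_cst.
by rewrite (_ : 'D_v _ = fun=> 0) //; apply/funext => x; rewrite derive_cst.
Qed.

Lemma Ck_onD (W : normedModType R) k (f g : V -> W) :
  Ck_on k A f -> Ck_on k A g -> Ck_on k A (fun x => f x + g x).
Proof.
elim: k W f g => [|k IH] W f g /=.
  by move=> fc gc x Ax; apply: continuousD; [exact: fc|exact: gc].
move=> [fd fD] [gd gD]; split=> [x Ax|v].
  by apply: differentiableD; [exact: fd|exact: gd].
apply: Ck_on_eq (IH _ _ _ (fD v) (gD v)) => x Ax.
by rewrite deriveD//; apply: diff_derivable; [exact: fd|exact: gd].
Qed.

(** A continuous linear map commutes with ['D_v], so the induction stays within the form [L \o f].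
    Matrix entries, pairs and projections reduce to this case. *)
Lemma Ck_on_comp_linear (W W' : normedModType R) (L : {linear W -> W'})
    k (f : V -> W) :
  continuous L -> Ck_on k A f -> Ck_on k A (L \o f).
Proof.
move=> cL; elim: k f => [|k IH] f /=.
  by move=> fc x Ax; apply: continuous_comp; [exact: fc|exact: cL].
move=> [fd fD]; split=> [x Ax|v].
  by apply: differentiable_comp; [exact: fd|exact: linear_differentiable].
apply: Ck_on_eq (IH _ (fD v)) => x Ax.
have dL y : differentiable L y by exact: linear_differentiable.
rewrite deriveE; last by apply: differentiable_comp; [exact: fd|].
rewrite diff_comp//=; last exact: fd.
by rewrite diff_lin//= deriveE//; exact: fd.
Qed.

Lemma Ck_on_scale (W : normedModType R) k (f : V -> R) (g : V -> W) :
  Ck_on k A f -> Ck_on k A g -> Ck_on k A (fun x => f x *: g x).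
Proof.
elim: k W f g => [|k IH] W f g.
  by move=> fc gc x Ax; apply: continuousZ; [exact: fc|exact: gc].
move=> fC gC; have [fd fD] := fC; have [gd gD] := gC; split=> [x Ax|v].
  by have [] := is_diff_scale_fun (fd x Ax) (gd x Ax).
(* Each term of the product rule has one differentiated factor, of class C^k, and one factor of
   class C^(k+1), which [Ck_onS] lowers to C^k. *)
have := Ck_onD (IH _ _ _ (Ck_onS fC) (gD v)) (IH _ _ _ (fD v) (Ck_onS gC)).
apply: Ck_on_eq => x Ax; have [dfg dE] := is_diff_scale_fun (fd x Ax) (gd x Ax).
by rewrite (deriveE _ dfg) dE (deriveE _ (fd x Ax)) (deriveE _ (gd x Ax)).
Qed.

Lemma Ck_onM k (f g : V -> R) :
  Ck_on k A f -> Ck_on k A g -> Ck_on k A (fun x => f x * g x).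
Proof. exact: Ck_on_scale. Qed.

Lemma Ck_onV k (f : V -> R) :
  (forall x, A x -> f x != 0) -> Ck_on k A f -> Ck_on k A (fun x => (f x)^-1).
Proof.
move=> f0; elim: k => [|k IH].
  by move=> fc x Ax; apply: continuousV; [exact: f0|exact: fc].
move=> fC; have [fd fD] := fC; split=> [x Ax|v].
  by apply: differentiableV; [exact: fd|exact: f0].
(* The derivative of the inverse is [- (f^-1 * f^-1) * 'D_v f], so its class C^k follows from that
   of [f^-1] itself. *)
have fV := IH (Ck_onS fC).
have := Ck_on_scale (Ck_on_cst k (- 1 : R))
  (Ck_on_scale (Ck_on_scale fV fV) (fD v)).
apply: Ck_on_eq => x Ax.
rewrite deriveV; [|exact: f0|apply: diff_derivable; exact: fd].
by rewrite scaleN1r scaleNr expr2 invfM.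
Qed.

Lemma Ck_onB (W : normedModType R) k (f g : V -> W) :
  Ck_on k A f -> Ck_on k A g -> Ck_on k A (fun x => f x - g x).
Proof.
move=> fC gC; have := Ck_onD fC (Ck_on_scale (Ck_on_cst k (-1 : R)) gC).
by apply: Ck_on_eq => x _; rewrite scaleN1r.
Qed.

Lemma Ck_on_sum (W : normedModType R) k (I : Type) (s : seq I) (P : pred I)
    (F : I -> V -> W) :
  (forall i, P i -> Ck_on k A (F i)) ->
  Ck_on k A (fun x => \sum_(i <- s | P i) F i x).
Proof.
move=> FC; elim: s => [|i s IH].
  by apply: Ck_on_eq (Ck_on_cst k 0) => x _; rewrite big_nil.
have [Pi|nPi] := boolP (P i).
  by apply: Ck_on_eq (Ck_onD (FC i Pi) IH) => x _; rewrite big_cons Pi.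
by apply: Ck_on_eq IH => x _; rewrite big_cons (negbTE nPi).
Qed.

Lemma Ck_on_prod k (I : Type) (s : seq I) (F : I -> V -> R) :
  (forall i, Ck_on k A (F i)) -> Ck_on k A (fun x => \prod_(i <- s) F i x).
Proof.
move=> FC; elim: s => [|i s IH].
  by apply: Ck_on_eq (Ck_on_cst k (1 : R)) => x _; rewrite big_nil.
by apply: Ck_on_eq (Ck_onM (FC i) IH) => x _; rewrite big_cons.
Qed.

Lemma Ck_on_coord k m n (f : V -> 'M[R]_(m, n)) i j :
  Ck_on k A f -> Ck_on k A (fun x => f x i j).
Proof.
have Llin : linear (fun N : 'M[R]_(m, n) => N i j : R).
  by move=> a M N; rewrite !mxE.
pose L : {linear 'M[R]_(m, n) -> R} :=
  HB.pack (fun N : 'M[R]_(m, n) => N i j)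
    (GRing.isLinear.Build _ _ _ _ _ Llin).
by move=> fC; apply: (@Ck_on_comp_linear _ _ L) => //; exact: coord_continuous.
Qed.

Lemma Ck_on_mx k m n (f : V -> 'M[R]_(m, n)) :
  (forall i j, Ck_on k A (fun x => f x i j)) -> Ck_on k A f.
Proof.
move=> fC; have C1 : Ck_on k A
    (fun x => \sum_i \sum_j f x i j *: (delta_mx i j : 'M[R]_(m, n))).
  apply: Ck_on_sum => i _; apply: Ck_on_sum => j _.
  by apply: Ck_on_scale (fC i j) _; exact: Ck_on_cst.
by apply: Ck_on_eq C1 => x _; rewrite -matrix_sum_delta.
Qed.

Lemma Ck_on_mulmx k m n p (f : V -> 'M[R]_(m, n)) (g : V -> 'M[R]_(n, p)) :
  Ck_on k A f -> Ck_on k A g -> Ck_on k A (fun x => f x *m g x).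
Proof.
move=> fC gC; apply: Ck_on_mx => i j.
have C1 : Ck_on k A (fun x => \sum_l f x i l *: g x l j).
  by apply: Ck_on_sum => l _; apply: Ck_on_scale; exact: Ck_on_coord.
by apply: Ck_on_eq C1 => x _; rewrite mxE.
Qed.

Lemma Ck_on_trmx k m n (f : V -> 'M[R]_(m, n)) :
  Ck_on k A f -> Ck_on k A (fun x => (f x)^T).
Proof.
move=> fC; apply: Ck_on_mx => i j.
by apply: Ck_on_eq (Ck_on_coord j i fC) => x _; rewrite mxE.
Qed.

Lemma Ck_on_det k n (f : V -> 'M[R]_n) :
  Ck_on k A f -> Ck_on k A (fun x => \det (f x)).
Proof.
move=> fC; rewrite /determinant; apply: Ck_on_sum => s _.
apply: Ck_onM; first exact: Ck_on_cst.
by apply: Ck_on_prod => i; exact: Ck_on_coord.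
Qed.

(** Cramer's rule: the inverse is the adjugate, polynomial in the entries, divided by the
    nonvanishing determinant. *)
Lemma Ck_on_invmx k n (f : V -> 'M[R]_n) :
  (forall x, A x -> f x \in unitmx) -> Ck_on k A f ->
  Ck_on k A (fun x => invmx (f x)).
Proof.
move=> fU fC.
have adjC : Ck_on k A (fun x => \adj (f x)).
  apply: Ck_on_mx => i j; apply: (Ck_on_eq _ (f := fun x =>
      (-1) ^+ (j + i) *: \det (row' j (col' i (f x))))).
    by move=> x _; rewrite [RHS]mxE.
  apply: Ck_on_scale; first exact: Ck_on_cst.
  apply: Ck_on_det; apply: Ck_on_mx => a b.
  apply: Ck_on_eq (Ck_on_coord (lift j a) (lift i b) fC) => x _.
  by rewrite !mxE.
have detC : Ck_on k A (fun x => (\det (f x))^-1).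
  apply: Ck_onV; last exact: Ck_on_det.
  by move=> x /fU; rewrite unitmxE unitfE.
by apply: Ck_on_eq (Ck_on_scale detC adjC) => x /fU fxU; rewrite /invmx fxU.
Qed.

Lemma Ck_on_pair (W W' : normedModType R) k (f : V -> W) (g : V -> W') :
  Ck_on k A f -> Ck_on k A g -> Ck_on k A (fun x => (f x, g x)).
Proof.
have L1 : linear (fun w : W => (w, 0 : W')).
  by move=> a u v; apply/pair_equal_spec; split=> //=; rewrite scaler0 addr0.
have L2 : linear (fun w : W' => (0 : W, w)).
  by move=> a u v; apply/pair_equal_spec; split=> //=; rewrite scaler0 addr0.
pose l1 : {linear W -> (W * W')%type} :=
  HB.pack (fun w : W => (w, 0 : W')) (GRing.isLinear.Build _ _ _ _ _ L1).
pose l2 : {linear W' -> (W * W')%type} :=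
  HB.pack (fun w : W' => (0 : W, w)) (GRing.isLinear.Build _ _ _ _ _ L2).
have c1 : continuous l1.
  by move=> w; apply: cvg_pair; [exact: cvg_id|exact: cvg_cst].
have c2 : continuous l2.
  by move=> w; apply: cvg_pair; [exact: cvg_cst|exact: cvg_id].
move=> fC gC.
apply: Ck_on_eq (Ck_onD (Ck_on_comp_linear c1 fC) (Ck_on_comp_linear c2 gC)).
by move=> x _; apply/pair_equal_spec; split=> /=; rewrite ?addr0 ?add0r.
Qed.

Lemma Ck_on_fst (W W' : normedModType R) k (f : V -> W * W') :
  Ck_on k A f -> Ck_on k A (fun x => (f x).1).
Proof. by apply: Ck_on_comp_linear => w; exact: cvg_fst. Qed.

Lemma Ck_on_snd (W W' : normedModType R) k (f : V -> W * W') :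
  Ck_on k A f -> Ck_on k A (fun x => (f x).2).
Proof. by apply: Ck_on_comp_linear => w; exact: cvg_snd. Qed.

Lemma Ck_on_id k : Ck_on k A (@id V).
Proof.
case: k => [|k]; first by move=> x _; exact: cvg_id.
split=> [x _|v]; first exact: (@ex_diff _ _ _ _ _ _ _ (is_diff_id x)).
by apply: Ck_on_eq (Ck_on_cst k v) => x _; rewrite derive_id.
Qed.

End SmoothCalculus.

(** * Derivatives of curves and of matrix-valued maps *)

Lemma is_derive_scale_fun (R : realType) (V W : normedModType R)
    (f : V -> R) (g : V -> W) (x v : V) :
  differentiable f x -> differentiable g x ->
  is_derive x v (fun y => f y *: g y) (f x *: 'D_v g x + 'D_v f x *: g x).
Proof.
move=> df dg; have [dfg dE] := is_diff_scale_fun df dg.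
apply: DeriveDef; first exact: diff_derivable.
by rewrite (deriveE _ dfg) dE (deriveE _ df) (deriveE _ dg).
Qed.

Section CurveExpansion.
Context {R : realType} {W : normedModType R}.
Implicit Types (x v a w : W) (E : R^o -> W).

Let is_derive_expn_scale n E (t : R^o) : differentiable E t ->
  is_derive t 1 (fun s : R^o => s ^+ n.+1 *: E s)
    (t ^+ n.+1 *: 'D_1 E t + (n.+1%:R * t ^+ n) *: E t).
Proof.
move=> dE; have dX : derivable (fun s : R^o => s ^+ n.+1 : R) t 1.
  exact: exprn_derivable.
have := @is_derive_scale_fun _ R^o W _ E t 1 ((derivable1_diffP _ _).1 dX) dE.
by rewrite exp_derive /= [_ *: 1]mulr1.
Qed.

(** In the derivative of [c] the remainder becomes [t ^+ 2] times a map differentiable at 0, so it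
    contributes to neither the velocity nor the acceleration at 0. *)
Lemma curve_taylor2 x v a E :
  Ck_on 2 setT E ->
  let c := fun t : R^o => x + t *: v + t ^+ 2 *: a + t ^+ 3 *: E t in
  [/\ c 0 = x, is_derive (0 : R^o) 1 c v &
      is_derive (0 : R^o) 1 (derive1 c) (a *+ 2)].
Proof.
move=> [dE /(_ 1) [dE' _]] c.
have dC w (t : R^o) : differentiable (fun=> w : W) t.
  exact: differentiable_cst.
have c' t : is_derive (t : R^o) 1 c
    (v + (t *+ 2) *: a + (t ^+ 3 *: 'D_1 E t + (3 * t ^+ 2) *: E t)).
  have d1 := is_derive_expn_scale 0 (dC v t).
  have d2 := is_derive_expn_scale 1 (dC a t).
  have d3 := is_derive_expn_scale 2 (dE t I).
  rewrite !derive_cst ?scaler0 ?add0r in d1 d2.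
  have := is_deriveD (is_deriveD (is_deriveD (is_derive_cst x t 1) d1) d2) d3.
  by rewrite !expr0 mulr1 scale1r add0r expr1 mulr_natl.
have c'E : derive1 c =
    (fun t : R^o => v + t *: (a *+ 2) + t ^+ 2 *: (t *: 'D_1 E t + 3 *: E t)).
  apply/funext => t; rewrite derive1E; have [_ ->] := c' t.
  rewrite -(scalerMnl t) (scalerMnr t); congr (_ + _).
  by rewrite scalerDr !scalerA -exprSr [3 * _]mulrC.
split; first by rewrite /c !expr0n !scale0r !addr0.
  have := c' 0; rewrite mul0rn !expr0n /= mulr0 !scale0r !addr0; exact.
rewrite c'E; have dG : differentiable
    (fun t : R^o => t *: 'D_1 E t + 3 *: E t) (0 : R^o).
  apply: differentiableD; last exact: differentiableZ (dE 0 I).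
  have d_id := @ex_diff _ _ _ _ _ _ _ (is_diff_id (0 : R^o)).
  by have [] := is_diff_scale_fun d_id (dE' 0 I).
have d1 := is_derive_expn_scale 0 (dC (a *+ 2) 0).
have d2 := is_derive_expn_scale 1 dG.
rewrite !derive_cst ?scaler0 ?add0r in d1.
have := is_deriveD (is_deriveD (is_derive_cst v (0 : R^o) 1) d1) d2.
by rewrite !expr0n /= !mulr0 !scale0r mulr1 scale1r add0r !addr0.
Qed.
End CurveExpansion.

Section DeriveMatrix.
Context {R : realType} {V : normedModType R}.

Lemma is_derive_mxP m n (f : V -> 'M[R]_(m, n)) (x v : V) df :
  is_derive x v f df <-> forall i j, is_derive x v (fun y => f y i j) (df i j).
Proof.
split=> [[fd <-] i j|fd].
  apply: DeriveDef; first exact: (derivable_mxP _ _ _).1.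
  by rewrite derive_mx// mxE.
have fder : derivable f x v by apply/derivable_mxP => i j; have [] := fd i j.
apply: DeriveDef => //; rewrite derive_mx//; apply/matrixP => i j.
by rewrite mxE; have [_ <-] := fd i j.
Qed.

Lemma is_derive_mulmx m n p (f : V -> 'M[R]_(m, n)) (g : V -> 'M[R]_(n, p))
    (x v : V) df dg :
  is_derive x v f df -> is_derive x v g dg ->
  is_derive x v (fun y => f y *m g y) (df *m g x + f x *m dg).
Proof.
move=> /is_derive_mxP fd /is_derive_mxP gd; apply/is_derive_mxP => i j.
have h : (fun y => (f y *m g y) i j) =
    \sum_(l < n) ((fun y => f y i l) * (fun y => g y l j)).
  by apply/funext => y; rewrite mxE fct_sumE.
rewrite h; have := is_derive_sum (fun l : 'I_n => is_deriveM (fd i l) (gd l j)).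
rewrite !mxE -big_split /=; congr is_derive; apply: eq_bigr => l _.
by rewrite addrC [g x l j *: _]mulrC.
Qed.

Lemma is_derive_trmx m n (f : V -> 'M[R]_(m, n)) (x v : V) df :
  is_derive x v f df -> is_derive x v (fun y => (f y)^T) df^T.
Proof.
move=> /is_derive_mxP fd; apply/is_derive_mxP => i j; rewrite mxE.
by under eq_fun do rewrite mxE; exact: fd.
Qed.

Lemma is_derive_comp_linear (W W' : normedModType R) (L : {linear W -> W'})
    (f : V -> W) (x v : V) :
  continuous L -> differentiable f x -> is_derive x v (L \o f) (L ('D_v f x)).
Proof.
move=> cL fd.
have Ld y : differentiable L y by exact: linear_differentiable.
have Lfd : differentiable (L \o f) x by exact: differentiable_comp.
apply: DeriveDef; first exact: diff_derivable.
by rewrite (deriveE _ Lfd) diff_comp//= diff_lin//= deriveE.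
Qed.

(** Serves to differentiate the defining equations of the manifold along a curve on it. *)
Lemma is_derive_locally_cst (W : normedModType R) (f : V -> W) (w : W)
    (x v : V) df :
  (\forall y \near x, f y = w) -> is_derive x v f df -> df = 0.
Proof.
move=> fw fd; have [_ <-] := near_eq_is_derive fw fd.
by rewrite derive_cst.
Qed.

End DeriveMatrix.

(** * The Frobenius inner product *)

Section FrobeniusInnerProduct.
Context {R : realType}.

Lemma frobC m n (A B : 'M[R]_(m, n)) : frob A B = frob B A.
Proof. by rewrite /frob -mxtrace_tr trmx_mul trmxK. Qed.

Lemma frobDr m n (A B C : 'M[R]_(m, n)) : frob A (B + C) = frob A B + frob A C.
Proof. by rewrite /frob mulmxDr linearD. Qed.

Lemma frobZr m n a (A B : 'M[R]_(m, n)) : frob A (a *: B) = a * frob A B.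
Proof. by rewrite /frob -scalemxAr linearZ. Qed.

Lemma frobNr m n (A B : 'M[R]_(m, n)) : frob A (- B) = - frob A B.
Proof. by rewrite /frob mulmxN linearN. Qed.

Lemma frobDl m n (A B C : 'M[R]_(m, n)) : frob (A + B) C = frob A C + frob B C.
Proof. by rewrite !(frobC _ C) frobDr. Qed.

Lemma frobZl m n a (A B : 'M[R]_(m, n)) : frob (a *: A) B = a * frob A B.
Proof. by rewrite !(frobC _ B) frobZr. Qed.

Lemma frobNl m n (A B : 'M[R]_(m, n)) : frob (- A) B = - frob A B.
Proof. by rewrite !(frobC _ B) frobNr. Qed.

Lemma frob_sum m n (A B : 'M[R]_(m, n)) :
  frob A B = \sum_j \sum_i A i j * B i j.
Proof.
by rewrite /frob /mxtrace; apply: eq_bigr => j _; rewrite mxE;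
  apply: eq_bigr => i _; rewrite mxE.
Qed.

Lemma frob_ge0 m n (A : 'M[R]_(m, n)) : 0 <= frob A A.
Proof.
rewrite frob_sum; apply: sumr_ge0 => j _; apply: sumr_ge0 => i _.
by rewrite -expr2 sqr_ge0.
Qed.

(** Stated with an inequality so that a norm estimate ending in [frob A A <= 0] directly yields
    [A = 0]. *)
Lemma frob_le0 m n (A : 'M[R]_(m, n)) : frob A A <= 0 -> A = 0.
Proof.
move=> A0; have /eqP : frob A A = 0 by apply/eqP; rewrite eq_le A0 frob_ge0.
have A2 i j : 0 <= A i j * A i j by rewrite -expr2 sqr_ge0.
rewrite frob_sum psumr_eq0; last by move=> j _; apply: sumr_ge0.
move=> /allP H; apply/matrixP => i j; have := H j (mem_index_enum _).
rewrite psumr_eq0// => /allP /(_ i (mem_index_enum _)) /=.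
by rewrite mulf_eq0 orbb mxE => /eqP.
Qed.

Lemma frob_gt0 m n (A : 'M[R]_(m, n)) : A != 0 -> 0 < frob A A.
Proof.
move=> A0; rewrite lt_neqAle frob_ge0 andbT eq_sym.
by apply: contra_neq A0 => h; apply: frob_le0; rewrite h.
Qed.

Lemma frob_mulr m n p (A : 'M[R]_(m, n)) (B : 'M[R]_(n, p)) (C : 'M[R]_(m, p)) :
  frob (A *m B) C = frob B (A^T *m C).
Proof. by rewrite /frob trmx_mul mulmxA. Qed.

Lemma Stiefel_frob n (u : 'cV[R]_n) : Stiefel u <-> frob u u = 1.
Proof.
rewrite /Stiefel /frob /=; split=> [->|h]; first by rewrite mxtrace1.
by apply/matrixP => i j; rewrite !ord1 [RHS]mxE eqxx -h /mxtrace big_ord1.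
Qed.

End FrobeniusInnerProduct.

(** * Existence of the singular value decomposition *)

Section SingularValues.
Context {R : realType}.

Lemma Ck_on_frob (V : normedModType R) (A : set V) k m n
    (f g : V -> 'M[R]_(m, n)) :
  open A -> Ck_on k A f -> Ck_on k A g -> Ck_on k A (fun x => frob (f x) (g x)).
Proof.
move=> oA fC gC; rewrite /frob /mxtrace; apply: Ck_on_sum => // i _.
by apply: Ck_on_coord => //; apply: Ck_on_mulmx => //; exact: Ck_on_trmx.
Qed.

Lemma compact_unit_sphere n : compact [set x : 'rV[R]_n | frob x x = 1].
Proof.
apply: bounded_closed_compact.
  exists 1; split; first exact: num_real.
  move=> M M1 x /= fx; rewrite (le_trans _ (ltW M1))//.
  (* The square of one entry is at most the sum of all squares, which is 1; this bounds the max
     norm. *)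
  rewrite [leLHS]/Num.norm/= mx_normrE; apply: bigmax_le => // -[i j] _ /=.
  rewrite -(@expr_le1 _ 2)// -normrX ger0_norm ?sqr_ge0// -fx frob_sum.
  rewrite (bigD1 j)//= big_ord1 ord1 expr2 lerDl.
  by apply: sumr_ge0 => k _; rewrite big_ord1 -expr2 sqr_ge0.
rewrite (_ : [set _ | _] = (fun x : 'rV[R]_n => frob x x) @^-1` [set 1])//.
apply: closed_comp; last exact: closed_eq.
move=> x _; have C0 : Ck_on 0 setT (fun x : 'rV[R]_n => frob x x).
  by apply: (Ck_on_frob openT); exact: (Ck_on_id openT).
exact: (C0 x I).
Qed.

Lemma unit_delta n : frob (delta_mx 0 0 : 'cV[R]_n.+1) (delta_mx 0 0) = 1.
Proof.
rewrite -Stiefel_frob /Stiefel /= trmx_delta mul_delta_mx.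
by apply/matrixP => i j; rewrite !ord1 !mxE.
Qed.

(** The form is continuous on a product of two unit spheres, which is compact and, the dimensions
    being positive, nonempty. The maximum will be the largest singular value. The spheres consist of
    row vectors, as [compact_unit_sphere] requires, hence the transposes. *)
Lemma bilinear_form_max m n (Y : 'M[R]_(m.+1, n.+1)) :
  exists (u : 'cV[R]_m.+1) (v : 'cV[R]_n.+1),
    [/\ frob u u = 1, frob v v = 1 &
    forall (a : 'cV_m.+1) (b : 'cV_n.+1), frob a a = 1 -> frob b b = 1 ->
      frob a (Y *m b) <= frob u (Y *m v)].
Proof.
pose D := [set x : 'rV[R]_m.+1 | frob x x = 1] `*`
          [set x : 'rV[R]_n.+1 | frob x x = 1].
pose f (p : 'rV[R]_m.+1 * 'rV[R]_n.+1) := frob p.1^T (Y *m p.2^T).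
have frobT p q (A : 'M[R]_(p, q)) : frob A^T A^T = frob A A.
  by rewrite /frob mxtrace_mulC trmxK.
have D0 : D !=set0.
  exists ((delta_mx 0 0)^T, (delta_mx 0 0)^T).
  by split; rewrite /= frobT unit_delta.
have cD : compact D by apply: compact_setX; exact: compact_unit_sphere.
have cf : {within D, continuous f}.
  apply: continuous_subspaceT => x; have C0 : Ck_on 0 setT f.
    apply: (Ck_on_frob openT).
      apply: (Ck_on_trmx openT); apply: (Ck_on_fst openT).
      exact: (Ck_on_id openT).
    apply: (Ck_on_mulmx openT); first exact: Ck_on_cst.
    apply: (Ck_on_trmx openT); apply: (Ck_on_snd openT).
    exact: (Ck_on_id openT).
  exact: (C0 x I).
have [[u v] /set_mem[/= u1 v1] M] := compact_EVT_max D0 cD cf.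
exists u^T, v^T; split; rewrite ?frobT// => a b a1 b1.
have /= := M (a^T, b^T); rewrite /f /= !trmxK; apply.
by apply/mem_set; split; rewrite /= frobT.
Qed.

(* The Cauchy-Schwarz equality case turns a maximum of a^T Y b over unit
   vectors into a pair of singular vectors. *)
Lemma maximizer_singular_vector m n (Y : 'M[R]_(m, n))
    (u : 'cV[R]_m) (v : 'cV[R]_n) :
  frob u u = 1 -> frob v v = 1 ->
  (forall a, frob a a = 1 -> frob a (Y *m v) <= frob u (Y *m v)) ->
  Y *m v = frob u (Y *m v) *: u.
Proof.
move=> u1 v1 M; set s := frob u (Y *m v); set w := Y *m v.
have s0 : 0 <= s.
  have := M (- u); rewrite frobNl frobNr opprK u1 => /(_ erefl).
  by rewrite frobNl -/s -subr_ge0 opprK -mulr2n pmulrn_lge0.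
have ws : frob w w <= s ^+ 2.
  have [->|w0] := eqVneq w 0.
    by rewrite /frob mulmx0 mxtrace0 sqr_ge0.
  set q := Num.sqrt (frob w w).
  have q0 : 0 < q by rewrite sqrtr_gt0 frob_gt0.
  have qE : frob w w = q * q by rewrite -expr2 sqr_sqrtr// frob_ge0.
  (* Testing maximality on the normalized vector [w] gives [q <= s]. *)
  have := M (q^-1 *: w); rewrite !(frobZl, frobZr) -/w qE mulKf ?gt_eqF//.
  rewrite mulVf ?gt_eqF// => /(_ erefl) qs.
  by rewrite -expr2 ler_pXn2r// nnegrE ltW.
(* The squared norm of [w - s *: u] is [frob w w - s ^+ 2], which is at most 0. *)
apply/eqP; rewrite -subr_eq0; apply/eqP; apply: frob_le0.
rewrite !(frobDl, frobDr, frobNl, frobNr, frobZl, frobZr) u1 (frobC w u) -/s.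
by move: ws; rewrite expr2 mulr1 -/s; lra.
Qed.

(* H is the Householder reflection exchanging the first basis vector and u. *)
Lemma orthogonal_first_column n (u : 'cV[R]_n.+1) : frob u u = 1 ->
  exists2 H : 'M[R]_n.+1, H^T *m H = 1%:M & H *m delta_mx 0 0 = u.
Proof.
move=> u1; set e := delta_mx 0 0; have e1 : frob e e = 1 by exact: unit_delta.
have [<-|ue] := eqVneq e u; first by exists 1%:M; rewrite ?trmx1 !mul1mx.
pose w := e - u; have w0 : w != 0 by rewrite subr_eq0.
have fw := frob_gt0 w0; pose c := 2 / frob w w.
have wwE : w^T *m w = (frob w w)%:M.
  by rewrite [LHS]mx11_scalar /frob /mxtrace big_ord1.
have weE : w^T *m e = (frob w e)%:M.
  by rewrite [LHS]mx11_scalar /frob /mxtrace big_ord1.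
exists (1%:M - c *: (w *m w^T)).
  have -> : (1%:M - c *: (w *m w^T))^T = 1%:M - c *: (w *m w^T).
    by rewrite linearB linearZ /= trmx1 trmx_mul trmxK.
  rewrite mulmxBl mul1mx mulmxBr mulmx1 -scalemxAl -scalemxAr scalerA.
  rewrite -mulmxA (mulmxA w^T) wwE mul_scalar_mx -scalemxAr scalerA.
  have -> : c * c * frob w w = c *+ 2.
    by rewrite /c mulr_natl; field; rewrite gt_eqF.
  by rewrite mulr2n scalerDl opprB addrK subrK.
rewrite mulmxBl mul1mx -scalemxAl -mulmxA weE mul_mx_scalar scalerA.
have -> : c * frob w e = 1.
  (* This holds because [e] and [u] have the same norm; it makes the reflection move [e] by exactly
     [- w]. *)
  have E : frob w w = 2 * frob w e.
    by rewrite /w !(frobDl, frobDr, frobNl, frobNr) u1 e1 (frobC e u); ring.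
  have d0 : frob w e != 0.
    by apply: contraTneq fw => d0; rewrite E d0 mulr0 ltxx.
  by rewrite /c E; field.
by rewrite scale1r /w opprB addrC subrK.
Qed.

End SingularValues.

Definition singular_value_diag (R : realType) r (S : 'M[R]_r) : Prop :=
  [/\ is_diag_mx S, forall i, 0 <= S i i &
      forall i j : 'I_r, (i <= j)%N -> S j j <= S i i].

Section SVD.
Context {R : realType}.

Lemma frob_delta_mx r (i : 'I_r) (A : 'M[R]_r) :
  frob (delta_mx i 0 : 'cV_r) (A *m delta_mx i 0) = A i i.
Proof.
by rewrite /frob trmx_delta -rowE -colE /mxtrace big_ord1 !mxE.
Qed.

Lemma lsubmx_col0 m n (A : 'M[R]_(m, 1 + n)) : lsubmx A = col 0 A.
Proof.
by apply/matrixP => i j; rewrite !mxE ord1; congr (A _ _); exact: val_inj.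
Qed.

Lemma usubmx_row0 m n (A : 'M[R]_(1 + m, n)) : usubmx A = row 0 A.
Proof.
by apply/matrixP => i j; rewrite !mxE ord1; congr (A _ _); exact: val_inj.
Qed.

Lemma singular_value_decomposition m r (Y : 'M[R]_(m, r)) : (r <= m)%N ->
  exists (U : 'M[R]_(m, r)) (S V : 'M[R]_r),
    [/\ Stiefel U, Stiefel V, singular_value_diag S & Y = U *m S *m V^T].
Proof.
elim: r m Y => [|r IH] m Y.
  exists 0, 0, 0; split; rewrite /Stiefel /=; try by apply/matrixP => - [].
  - by split=> [|[]//|[]//]; apply/is_diag_mxP => - [].
  - by apply/matrixP => i [].
case: m Y => // m Y rm.
have [u [v [u1 v1 M]]] := bilinear_form_max Y.
set s := frob u (Y *m v) in M.
have Yv : Y *m v = s *: u by apply: maximizer_singular_vector => // a /M; exact.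
(* The transposed form has the same maximum [s], with [u] and [v] exchanged. *)
have YTu : Y^T *m u = s *: v.
  have sE : s = frob v (Y^T *m u) by rewrite /s frobC frob_mulr.
  rewrite sE; apply: maximizer_singular_vector => // b b1.
  by rewrite -sE frobC frob_mulr trmxK; apply: M.
have [H HH He] := orthogonal_first_column u1.
have [G GG Ge] := orthogonal_first_column v1.
have HHT := mulmx1C HH; have GGT := mulmx1C GG.
pose Y1 : 'M[R]_(1 + m, 1 + r) := H^T *m Y *m G.
(* The first column of [Y1] is [H^T *m Y *m v = s *: (H^T *m u)], a multiple of the first basis
   vector; the first row is treated likewise through [YTu]. *)
have Y1l : lsubmx Y1 = s *: delta_mx 0 0.
  rewrite lsubmx_col0 colE /Y1 -!mulmxA Ge Yv -scalemxAr -He.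
  by rewrite mulmxA HH mul1mx.
have Y1u : usubmx Y1 = s *: delta_mx 0 0.
  apply: trmx_inj; rewrite usubmx_row0 rowE /Y1 !trmx_mul trmxK trmx_delta.
  rewrite linearZ /= trmx_delta.
  by rewrite -!mulmxA He YTu -scalemxAr -Ge mulmxA GG mul1mx.
have YY1 : Y = H *m Y1 *m G^T.
  by rewrite /Y1 !mulmxA HHT mul1mx -mulmxA GGT mulmx1.
clearbody Y1; have Y1E : Y1 = block_mx s%:M 0 0 (drsubmx Y1).
  rewrite -[LHS]submxK /ulsubmx /ursubmx /dlsubmx; congr block_mx.
  - by rewrite Y1u; apply/matrixP => i j; rewrite !mxE !ord1 /= mulr1 mulr1n.
  - by rewrite Y1u; apply/matrixP => i j; rewrite !mxE !ord1 /= mulr0.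
  - apply/matrixP => i j; have /matrixP/(_ (rshift 1 i) j) := Y1l.
    by rewrite !mxE !ord1 /= mulr0.
have [U1 [S1 [V1 [UU VV [Sd S0 Ss] BE]]]] := IH m (drsubmx Y1) rm.
pose U : 'M[R]_(1 + m, 1 + r) := (H : 'M[R]_(1 + m)) *m block_mx 1%:M 0 0 U1.
pose V : 'M[R]_(1 + r) := (G : 'M[R]_(1 + r)) *m block_mx 1%:M 0 0 V1.
pose S : 'M[R]_(1 + r) := block_mx s%:M 0 0 S1.
have UST : Stiefel U.
  rewrite /Stiefel /= /U trmx_mul mulmxA -(mulmxA _ H^T) HH mulmx1.
  rewrite tr_block_mx mulmx_block !trmx0 !mul0mx !mulmx0 trmx1 mul1mx UU.
  by rewrite !addr0 !add0r -scalar_mx_block.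
have VST : Stiefel V.
  rewrite /Stiefel /= /V trmx_mul mulmxA -(mulmxA _ G^T) GG mulmx1.
  rewrite tr_block_mx mulmx_block !trmx0 !mul0mx !mulmx0 trmx1 mul1mx VV.
  by rewrite !addr0 !add0r -scalar_mx_block.
have YE : Y = U *m S *m V^T.
  rewrite YY1 /U /V /S trmx_mul -!mulmxA; congr (H *m _).
  rewrite !mulmxA; congr (_ *m _).
  rewrite {1}Y1E tr_block_mx !mulmx_block !trmx0 !mul0mx !mulmx0 trmx1.
  by rewrite !(addr0, add0r, mul0mx) mul1mx mulmx1 -BE.
clearbody U V; exists U, S, V; split=> //.
have SE : S = U^T *m Y *m V.
  by rewrite YE !mulmxA UST mul1mx -mulmxA VST mulmx1.
have s0 : 0 <= s.
  have := M (- u) v; rewrite frobNl !frobNr opprK u1 v1 => /(_ erefl erefl).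
  by rewrite frobNl -/s; lra.
(* [S i i] is the value of the bilinear form at the i-th columns of [U] and [V], which are unit
   vectors, so the maximum [s] dominates it. This gives the ordering. *)
have Ssle i : S i i <= s.
  have unit_mul p (A : 'M[R]_(p, r.+1)) : Stiefel A ->
      frob (A *m delta_mx i 0 : 'cV_p) (A *m delta_mx i 0) = 1.
    move=> AA; rewrite frob_mulr mulmxA AA frob_delta_mx.
    by rewrite mxE eqxx.
  rewrite -frob_delta_mx SE -!mulmxA -[X in frob _ (X *m _)]trmxK.
  by rewrite -frob_mulr trmxK; apply: M; exact: unit_mul.
have S00 (i : 'I_1) : S (lshift r i) (lshift r i) = s.
  by rewrite /S block_mxEul !ord1 mxE.
have Srr (i j : 'I_r) : S (rshift 1 i) (rshift 1 j) = S1 i j.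
  by rewrite /S block_mxEdr.
have S0r (i : 'I_1) (j : 'I_r) : S (lshift r i) (rshift 1 j) = 0.
  by rewrite /S block_mxEur mxE.
have Sr0 (i : 'I_r) (j : 'I_1) : S (rshift 1 i) (lshift r j) = 0.
  by rewrite /S block_mxEdl mxE.
split.
- apply/is_diag_mxP => /= i j; case: (@split_ordP 1 r i) => i' ->;
    case: (@split_ordP 1 r j) => j' -> ij.
  + by rewrite !ord1 in ij; rewrite eqxx in ij.
  + by rewrite S0r.
  + by rewrite Sr0.
  + rewrite Srr; apply: (is_diag_mxP Sd); apply: contra_neq ij => ij.
    by rewrite /= ij.
- by move=> i; case: (@split_ordP 1 r i) => i' ->; rewrite ?S00 ?Srr.
move=> i j; case: (@split_ordP 1 r i) => i' ->; first by rewrite S00.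
case: (@split_ordP 1 r j) => j' ->; first by rewrite /= [j']ord1.
by rewrite !Srr /= => ij; exact: Ss.
Qed.
End SVD.

(** * Orthogonal projectors, tangent equations and inverse square roots *)

Section Projectors.
Context {R : realType}.

(** The row space of [1%:M - P] is the kernel of [P]. *)
Lemma rank_projector_compl n (P : 'M[R]_n) :
  P *m P = P -> \rank (1%:M - P) = (n - \rank P)%N.
Proof.
move=> PP; rewrite -mxrank_ker; apply: eqmx_rank; apply/andP; split.
  by apply/sub_kermxP; rewrite mulmxBl mul1mx PP subrr.
have -> : kermx P = kermx P *m (1%:M - P).
  by rewrite mulmxBr mulmx1 mulmx_ker subr0.
exact: submxMl.
Qed.

Lemma rank_Stiefel n r (V : 'M[R]_(n, r)) : Stiefel V -> \rank (V *m V^T) = r.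
Proof.
move=> VV; apply/eqP; rewrite eqn_leq.
rewrite (leq_trans (mxrankM_maxl _ _) (rank_leq_col _)) /=.
rewrite -{1}(mxrank1 R r) -(_ : V^T *m (V *m V^T) *m V = 1%:M).
  by rewrite (leq_trans (mxrankM_maxl _ _) (mxrankM_maxr _ _)).
by rewrite mulmxA VV mul1mx VV.
Qed.

Lemma Grassmann_Stiefel n r (V : 'M[R]_(n, r)) :
  Stiefel V -> Grassmann (n - r) (1%:M - V *m V^T).
Proof.
move=> VV; have VVT : V *m V^T *m (V *m V^T) = V *m V^T.
  by rewrite mulmxA -(mulmxA V) VV mulmx1.
split.
- by rewrite linearB /= trmx1 trmx_mul trmxK.
- by rewrite mulmxBl mul1mx mulmxBr mulmx1 VVT subrr subr0.
- by rewrite rank_projector_compl // rank_Stiefel.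
Qed.

(** The left singular vectors of a basis of the range of [Q] form an orthonormal basis of that
    range. *)
Lemma orthogonal_projector_Stiefel n r (Q : 'M[R]_n) :
  Q^T = Q -> Q *m Q = Q -> \rank Q = r ->
  exists2 V : 'M[R]_(n, r), Stiefel V & Q = V *m V^T.
Proof.
move=> QT QQ <-; have [|U [S [W [UU _ _ BE]]]] :=
  singular_value_decomposition (row_base Q)^T; first exact: rank_leq_row.
have [D QD] : exists D, Q = D *m row_base Q.
  by apply/submxP; rewrite eq_row_base.
have QU : (Q <= U^T)%MS.
  apply/submxP; exists (D *m (W *m S^T)).
  by rewrite [LHS]QD -[row_base Q]trmxK BE !trmx_mul trmxK !mulmxA.
(* [U^T] has as many rows as the rank of [Q], so the inclusion [QU] is an equality of row spaces. *)
have UQ : (U^T <= Q)%MS.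
  have [_ <-] := mxrank_leqif_sup QU.
  by rewrite eqn_leq (mxrankS QU) rank_leq_row.
exists U => //; have [F UF] := submxP UQ; have [E QE] := submxP QU.
have UTQ : U^T *m Q = U^T by rewrite {1}UF -mulmxA QQ.
have QUU : Q *m U = U by apply: trmx_inj; rewrite trmx_mul QT.
have : E *m U^T *m U *m U^T = E *m U^T by rewrite -(mulmxA E) UU mulmx1.
by rewrite -QE QUU.
Qed.

End Projectors.

(** Obtained by differentiating [P^T = P], [P *m P = P] and [X *m P = 0] along a curve on the
    manifold. These linear equations are what produces the pair [K], [Vp] later. *)
Lemma desing_tangent_eqs (R : realType) (m n r : nat) (x v : ambient R m n) :
  tangent_space (desing R m n r) x v ->
  [/\ v.2^T = v.2, v.2 *m x.2 + x.2 *m v.2 = v.2 &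
      v.1 *m x.2 + x.1 *m v.2 = 0].
Proof.
move=> [e [c [e0 cC cM c0 dc]]].
have near_c : \forall t \near (0 : R^o), desing R m n r (c t).
  have I0 : (0 : R) \in `]- e, e[ by rewrite in_itv /= oppr_lt0 e0.
  by apply: filterS (near_in_itvoo I0) => t; exact: cM.
have [cd _] := cC 1%N.
have {}cd : differentiable c (0 : R^o).
  by apply: cd; rewrite /= in_itv /= oppr_lt0 e0.
have d1 : is_derive (0 : R^o) 1 (fun t => (c t).1) v.1.
  have [_ <-] := dc.
  by apply: (@is_derive_comp_linear _ _ _ _ fst) => // w; exact: cvg_fst.
have d2 : is_derive (0 : R^o) 1 (fun t => (c t).2) v.2.
  have [_ <-] := dc.
  by apply: (@is_derive_comp_linear _ _ _ _ snd) => // w; exact: cvg_snd.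
split.
- apply/eqP; rewrite -subr_eq0; apply/eqP.
  apply: is_derive_locally_cst (is_deriveB (is_derive_trmx d2) d2).
  by apply: filterS near_c => t [[+ _ _] _]; rewrite !fctE => ->; exact: subrr.
- apply/eqP; rewrite -subr_eq0; apply/eqP; rewrite -c0.
  apply: is_derive_locally_cst (is_deriveB (is_derive_mulmx d2 d2) d2).
  by apply: filterS near_c => t [[_ + _] _]; rewrite !fctE => ->; exact: subrr.
- rewrite -c0; apply: is_derive_locally_cst (is_derive_mulmx d1 d2).
  by apply: filterS near_c => t [_ ->].
Qed.



(** With [Z = U S V^T], the Gram matrix is [V S^2 V^T], and its invertibility makes the singular
    values positive. Hence [V S^-1 V^T] is a witness, and [xget] does not fall back on its default
    0. *)
Lemma invsqrtmxP (R : realType) (n r : nat) (Z : 'M[R]_(n, r)) :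
  (r <= n)%N -> Z^T *m Z \in unitmx ->
  let B := invsqrtmx (Z^T *m Z) in
  posdefmx B /\ B *m B = invmx (Z^T *m Z).
Proof.
move=> rn ZU B; suff [C HC] : [set B | [/\ Z^T *m Z \in unitmx, posdefmx B &
    B *m B = invmx (Z^T *m Z)]] !=set0.
  by have [] := xgetPex 0 (ex_intro _ C HC).
have [U [S [V [UU VV [Sd S0 _] ZE]]]] := singular_value_decomposition Z rn.
have /diag_mxP [d SE] := Sd.
have ST : S^T = S by rewrite SE tr_diag_mx.
have ZZ : Z^T *m Z = V *m S *m S *m V^T.
  by rewrite ZE !trmx_mul trmxK ST !mulmxA -(mulmxA _ U^T) UU mulmx1.
have VVT := mulmx1C VV.
have d0 i : 0 < d 0 i.
  rewrite lt_neqAle; have := S0 i; rewrite SE !mxE eqxx mulr1n => -> /[!andbT].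
  apply: contraTneq ZU => di; rewrite unitmxE unitfE negbK ZZ !det_mulmx.
  have -> : \det S = 0 by rewrite SE det_diag (bigD1 i)//= -di mul0r.
  by rewrite mulr0 !mul0r.
pose T := diag_mx (\row_i (d 0 i)^-1).
have ST1 : S *m T = 1%:M.
  rewrite SE /T mulmx_diag -diag_const_mx; congr diag_mx; apply/rowP => i.
  by rewrite !mxE mulfV// gt_eqF.
have TT : T^T = T by rewrite /T tr_diag_mx.
exists (V *m T *m V^T); split=> //; last first.
  have E : Z^T *m Z *m (V *m T *m V^T *m (V *m T *m V^T)) = 1%:M.
    rewrite ZZ !mulmxA -(mulmxA _ V^T) VV mulmx1 -(mulmxA _ V^T) VV mulmx1.
    by rewrite -(mulmxA _ S T) ST1 mulmx1 -(mulmxA _ S T) ST1 mulmx1.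
  by rewrite -[LHS]mul1mx -(mulVmx ZU) -[LHS]mulmxA E mulmx1.
split; first by rewrite !trmx_mul trmxK TT mulmxA.
move=> x x0; set y := V^T *m x.
have -> : x^T *m (V *m T *m V^T) *m x = y^T *m (T *m y).
  by rewrite /y trmx_mul trmxK !mulmxA.
have y0 : y != 0.
  by apply: contra_neq x0 => y0; rewrite -[x]mul1mx -VVT -mulmxA -/y y0 mulmx0.
clearbody y; have yE i : y^T 0 i * (T *m y) i 0 = (d 0 i)^-1 * y i 0 ^+ 2.
  by rewrite /T mul_diag_mx !mxE; ring.
have [i yi] : exists i, y i 0 != 0.
  apply: contrapT => /forallNP h; move: y0 => /eqP; apply; apply/colP => i.
  by apply/eqP; rewrite mxE; have /negP := h i; rewrite negbK.
rewrite mxE (bigD1 i)//= ltr_wpDr//.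
  by apply: sumr_ge0 => j _; rewrite yE mulr_ge0 ?sqr_ge0// invr_ge0 ltW.
by rewrite yE mulr_gt0 ?invr_gt0// exprn_even_gt0.
Qed.

(** * Existence of representations of points and tangent vectors *)

Section Representations.
Context {R : realType} {m n r : nat}.
Hypothesis r_lt : (r < minn m n)%N.

Let rm : (r <= m)%N.
Proof. by move: r_lt; rewrite leq_min => /andP[/ltnW]. Qed.

Let rn : (r <= n)%N.
Proof. by move: r_lt; rewrite leq_min => /andP[_ /ltnW]. Qed.

Lemma point_repr_exists (x : ambient R m n) : desing R m n r x ->
  exists (U : 'M[R]_(m, r)) (S : 'M[R]_r) (V : 'M[R]_(n, r)),
    point_repr x U S V.
Proof.
case: x => X P [[/= PT PP rP] XP].
have [||| V VV PV] := @orthogonal_projector_Stiefel _ n r (1%:M - P).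
- by rewrite linearB /= trmx1 PT.
- by rewrite mulmxBl mul1mx mulmxBr mulmx1 PP subrr subr0.
- by rewrite rank_projector_compl// rP subKn.
(* The right factor [W] is orthogonal and only rotates the basis [V] of the kernel of [P]: [V *m W]
   has the same projector. *)
have [U [S [W [UU WW Sd XVE]]]] := singular_value_decomposition (X *m V) rm.
have WWT := mulmx1C WW.
have VWE : V *m W *m (V *m W)^T = V *m V^T.
  by rewrite trmx_mul mulmxA -(mulmxA V W) WWT mulmx1.
exists U, S, (V *m W); split=> //=.
- by rewrite /Stiefel /= trmx_mul mulmxA -(mulmxA W^T) VV mulmx1.
- rewrite trmx_mul mulmxA -XVE -mulmxA -PV mulmxBr mulmx1.
  by rewrite XP subr0.
- by rewrite VWE -PV subKr.
Qed.

(** Multiplying the required forms of [dX] and [dP] by [V] on the right forces [K = dX V] and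
    [Vp = - dP V]. *)
Lemma tangent_repr_exists (x v : ambient R m n)
    (U : 'M[R]_(m, r)) (S : 'M[R]_r) (V : 'M[R]_(n, r)) :
  point_repr x U S V ->
  [/\ v.2^T = v.2, v.2 *m x.2 + x.2 *m v.2 = v.2 &
      v.1 *m x.2 + x.1 *m v.2 = 0] ->
  exists K Vp, tangent_repr v U S V K Vp.
Proof.
case: x v => X P [dX dP] [UU VV _ /= XE PE] [/= dPT dPE dXE].
have PT : P^T = P by rewrite PE linearB /= trmx1 trmx_mul trmxK.
have PV : P *m V = 0 by rewrite PE mulmxBl mul1mx -mulmxA VV mulmx1 subrr.
have VTP : V^T *m P = 0 by rewrite -PT -trmx_mul PV trmx0.
(* Compressing [dP P + P dP = dP] by [V] on both sides kills both terms on the left; this is the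
   condition [Vp^T V = 0]. *)
have VTdPV : V^T *m dP *m V = 0.
  rewrite -{1}dPE mulmxDr mulmxDl !mulmxA VTP !mul0mx addr0 -mulmxA PV.
  by rewrite mulmx0.
have VVT : V *m V^T = 1%:M - P by rewrite PE subKr.
exists (dX *m V), (- (dP *m V)); split=> /=.
- by rewrite linearN /= mulNmx trmx_mul dPT VTdPV oppr0.
- rewrite linearN /= trmx_mul dPT mulmxN -mulmxA VVT mulmxBr mulmx1.
  by rewrite mulmxA -XE -addrA -opprD dXE subr0.
- rewrite linearN /= trmx_mul dPT mulmxN mulNmx !opprK -mulmxA VVT mulmxA VVT.
  rewrite mulmxBr mulmx1 mulmxBl mul1mx.
  by rewrite addrACA -opprD dPE addrK.
Qed.

End Representations.

(** * Algebra of second-order expansions of curves *)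

Section SecondOrderExpansion.
Context {R : realType}.

(** An exact identity with a smooth factor [E] on the whole line, rather than an estimate O(t^3): it
    is stable under products and inverses, and it can be differentiated twice. *)
Definition taylor2 (W : normedModType R) (f : R^o -> W) (f0 f1 f2 : W) : Prop :=
  exists2 E : R^o -> W, forall k, Ck_on k setT E &
    forall t, f t = f0 + t *: f1 + t ^+ 2 *: f2 + t ^+ 3 *: E t.

Let Ck_on_t k : Ck_on k setT (fun t : R^o => t : R).
Proof. exact: (Ck_on_id openT). Qed.

Lemma taylor2_Ck (W : normedModType R) (f : R^o -> W) f0 f1 f2 k :
  taylor2 f f0 f1 f2 -> Ck_on k setT f.
Proof.
move=> [E EC fE]; suff : Ck_on k setT
    (fun t : R^o => f0 + t *: f1 + t ^+ 2 *: f2 + t ^+ 3 *: E t).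
  by apply: (Ck_on_eq openT) => t _; rewrite fE.
have tX n : Ck_on k setT (fun t : R^o => t ^+ n : R).
  elim: n => [|n IH]; first exact: Ck_on_cst.
  apply: (Ck_on_eq openT) (Ck_onM openT (Ck_on_t k) IH) => t _.
  by rewrite exprS.
apply: (Ck_onD openT); last exact: (Ck_on_scale openT).
apply: (Ck_onD openT).
  apply: (Ck_onD openT); first exact: Ck_on_cst.
  by apply: (Ck_on_scale openT) => //; exact: Ck_on_cst.
by apply: (Ck_on_scale openT) => //; exact: Ck_on_cst.
Qed.

Lemma taylor2_cst (W : normedModType R) (w : W) : taylor2 (fun=> w) w 0 0.
Proof.
exists (fun=> 0) => [k|]; first exact: Ck_on_cst.
by move=> t; rewrite !scaler0 !addr0.
Qed.

Lemma taylor2_scale (W : normedModType R) (w : W) :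
  taylor2 (fun t => t *: w) 0 w 0.
Proof.
exists (fun=> 0) => [k|]; first exact: Ck_on_cst.
by move=> t; rewrite !scaler0 !addr0 add0r.
Qed.

Lemma taylor2D (W : normedModType R) (f g : R^o -> W) f0 f1 f2 g0 g1 g2 :
  taylor2 f f0 f1 f2 -> taylor2 g g0 g1 g2 ->
  taylor2 (fun t => f t + g t) (f0 + g0) (f1 + g1) (f2 + g2).
Proof.
move=> [E EC fE] [F FC gF]; exists (fun t => E t + F t) => [k|].
  exact: (Ck_onD openT).
by move=> t; rewrite fE gF !scalerDr [LHS]addrACA [X in X + _]addrACA
  [X in X + _ + _]addrACA.
Qed.

Lemma taylor2N (W : normedModType R) (f : R^o -> W) f0 f1 f2 :
  taylor2 f f0 f1 f2 -> taylor2 (fun t => - f t) (- f0) (- f1) (- f2).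
Proof.
move=> [E EC fE]; exists (fun t => (-1) *: E t) => [k|].
  by apply: (Ck_on_scale openT) => //; exact: Ck_on_cst.
by move=> t; rewrite fE !scalerN scaleN1r scalerN !opprD.
Qed.

Lemma taylor2M (f g : R^o -> R) (f0 f1 f2 g0 g1 g2 : R) :
  taylor2 f f0 f1 f2 -> taylor2 g g0 g1 g2 ->
  taylor2 (fun t => f t * g t : R) (f0 * g0) (f0 * g1 + f1 * g0)
    (f0 * g2 + f1 * g1 + f2 * g0).
Proof.
move=> fT gT; have gC k := taylor2_Ck k gT.
have [E EC fE] := fT; have [F FC gF] := gT.
(* The terms of order at least 3 of the product, divided by [t ^+ 3] and grouped by the factors
   [f0], [f1], [f2] and [E t] coming from [f]. *)
exists (fun t => f0 * F t + f1 * (g2 + t * F t) +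
    f2 * (g1 + t * (g2 + t * F t)) + E t * g t) => [k|]; last first.
  have E3 (s a b : R) : (f0 + s * f1 + s ^+ 2 * f2 + s ^+ 3 * a) *
      (g0 + s * g1 + s ^+ 2 * g2 + s ^+ 3 * b) =
      f0 * g0 + s * (f0 * g1 + f1 * g0) +
      s ^+ 2 * (f0 * g2 + f1 * g1 + f2 * g0) +
      s ^+ 3 * (f0 * b + f1 * (g2 + s * b) + f2 * (g1 + s * (g2 + s * b)) +
        a * (g0 + s * g1 + s ^+ 2 * g2 + s ^+ 3 * b)) by ring.
  by move=> t; rewrite fE gF; exact: E3.
do !apply: (Ck_onD openT) => //; repeat first
  [ exact: Ck_on_t | exact: Ck_on_cst | exact: FC | exact: EC | exact: gC
  | apply: (Ck_onD openT) | apply: (Ck_onM openT)].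
Qed.

Lemma taylor2_sum (W : normedModType R) n (f : 'I_n -> R^o -> W) f0 f1 f2 :
  (forall i, taylor2 (f i) (f0 i) (f1 i) (f2 i)) ->
  taylor2 (fun t => \sum_i f i t) (\sum_i f0 i) (\sum_i f1 i) (\sum_i f2 i).
Proof.
move=> fT; elim: (index_enum _) => [|i s IH].
  rewrite !big_nil; have := taylor2_cst (0 : W).
  by congr taylor2; apply/funext => t; rewrite big_nil.
rewrite !big_cons; have := taylor2D (fT i) IH.
by congr taylor2; apply/funext => t; rewrite big_cons.
Qed.

Lemma taylor2_mxP m n (f : R^o -> 'M[R]_(m, n)) f0 f1 f2 :
  taylor2 f f0 f1 f2 <->
  forall i j, taylor2 (fun t => f t i j : R) (f0 i j) (f1 i j) (f2 i j).
Proof.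
split=> [[E EC fE] i j|fT].
  exists (fun t => E t i j) => [k|]; first exact: (Ck_on_coord openT).
  by move=> t; rewrite fE !mxE.
exists (fun t => \matrix_(i, j) s2val (cid2 (fT i j)) t) => [k|].
  apply: (Ck_on_mx openT) => i j.
  by apply: (Ck_on_eq openT) (s2valP (cid2 (fT i j)) k) => t _; rewrite mxE.
by move=> t; apply/matrixP => i j; rewrite !mxE (s2valP' (cid2 (fT i j))).
Qed.

Lemma taylor2_trmx m n (f : R^o -> 'M[R]_(m, n)) f0 f1 f2 :
  taylor2 f f0 f1 f2 -> taylor2 (fun t => (f t)^T) f0^T f1^T f2^T.
Proof.
move=> /taylor2_mxP fT; apply/taylor2_mxP => i j; rewrite !mxE.
by under eq_fun do rewrite mxE; exact: fT.
Qed.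

Lemma taylor2_mulmx m n p (f : R^o -> 'M[R]_(m, n)) (g : R^o -> 'M[R]_(n, p))
    f0 f1 f2 g0 g1 g2 :
  taylor2 f f0 f1 f2 -> taylor2 g g0 g1 g2 ->
  taylor2 (fun t => f t *m g t) (f0 *m g0) (f0 *m g1 + f1 *m g0)
    (f0 *m g2 + f1 *m g1 + f2 *m g0).
Proof.
move=> /taylor2_mxP fT /taylor2_mxP gT; apply/taylor2_mxP => i j.
have := taylor2_sum (fun l : 'I_n => taylor2M (fT i l) (gT l j)).
rewrite !mxE !big_split /=; congr taylor2.
by apply/funext => t; rewrite mxE.
Qed.

(** With [f = 1 + t^2 h] and [h = N + t E], the identity [f^-1 = 1 - t^2 h f^-1] used twice gives
    [f^-1 = 1 - t^2 h + t^4 h h f^-1]. Invertibility at every [t] keeps the remainder smooth on the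
    whole line. *)
Lemma taylor2_invmx n (f : R^o -> 'M[R]_n) (N : 'M[R]_n) :
  (forall t, f t \in unitmx) -> taylor2 f 1%:M 0 N ->
  taylor2 (fun t => invmx (f t)) 1%:M 0 (- N).
Proof.
move=> fU fT; have fC k := taylor2_Ck k fT; have [E EC fE] := fT.
pose h t := N + t *: E t.
have hC k : Ck_on k setT h.
  apply: (Ck_onD openT); first exact: Ck_on_cst.
  by apply: (Ck_on_scale openT) => //; exact: Ck_on_t.
have fiC k : Ck_on k setT (fun t => invmx (f t)) by exact: (Ck_on_invmx openT).
exists (fun t => (-1) *: E t + t *: (h t *m h t *m invmx (f t))) => [k|].
  apply: (Ck_onD openT).
    by apply: (Ck_on_scale openT) => //; exact: Ck_on_cst.
  apply: (Ck_on_scale openT); first exact: Ck_on_t.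
  by do 2!apply: (Ck_on_mulmx openT) => //.
move=> t; have fh : f t = 1%:M + t ^+ 2 *: h t.
  by rewrite fE scaler0 addr0 /h scalerDr scalerA -exprSr addrA.
have E1 : invmx (f t) = 1%:M - t ^+ 2 *: (h t *m invmx (f t)).
  apply/eqP; rewrite eq_sym subr_eq eq_sym scalemxAl.
  rewrite -{1}[invmx _]mul1mx -mulmxDl -fh.
  by rewrite mulmxV.
rewrite {1}E1 {1}E1 mulmxBr mulmx1 -scalemxAr scalerBr opprB scalerA mulmxA.
rewrite /h; set H := _ *m invmx _.
rewrite scaler0 addr0 scaleN1r !(scalerDr, scalerN) !scalerA -exprSr.
rewrite -exprD -exprSr opprD -[RHS]addrA; congr (_ + _).
by rewrite [LHS]addrC -[LHS]addrA.
Qed.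

Lemma taylor2_pair (W W' : normedModType R) (f : R^o -> W) (g : R^o -> W')
    f0 f1 f2 g0 g1 g2 :
  taylor2 f f0 f1 f2 -> taylor2 g g0 g1 g2 ->
  taylor2 (fun t => (f t, g t)) (f0, g0) (f1, g1) (f2, g2).
Proof.
move=> [E EC fE] [F FC gF]; exists (fun t => (E t, F t)) => [k|].
  exact: (Ck_on_pair openT).
by move=> t; apply/pair_equal_spec; split; rewrite /= ?fE ?gF.
Qed.

End SecondOrderExpansion.

(** * Invertibility of Gram matrices *)

Section PositiveDefinite.
Context {R : realType}.

Lemma unitmx_inj n (M : 'M[R]_n) :
  (forall y : 'cV_n, M *m y = 0 -> y = 0) -> M \in unitmx.
Proof.
move=> Minj; rewrite -unitmx_tr -row_free_unit -kermx_eq0; apply/eqP.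
apply/row_matrixP => i; rewrite row0; apply: trmx_inj; rewrite trmx0.
apply: Minj; apply: trmx_inj; rewrite trmx_mul trmxK trmx0 -row_mul.
by rewrite mulmx_ker row0.
Qed.

(** If [Z^T Z y = 0], then [Z y] has norm 0, and the left inverse [L] gives [y = 0]. *)
Lemma unitmx_gram n r (L : 'M[R]_(r, n)) (Z : 'M[R]_(n, r)) :
  L *m Z = 1%:M -> Z^T *m Z \in unitmx.
Proof.
move=> LZ; apply: unitmx_inj => y ZZy.
have Zy : Z *m y = 0.
  by apply: frob_le0; rewrite frob_mulr mulmxA ZZy /frob mulmx0 mxtrace0.
by rewrite -[y]mul1mx -LZ -mulmxA Zy mulmx0.
Qed.

(** Pairing a kernel vector [y] with its image gives [a |y|^2 + |X y|^2 = 0]. *)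
Lemma unitmx_add_gram m n (a : R) (X : 'M[R]_(m, n)) : 0 < a ->
  a%:M + X^T *m X \in unitmx.
Proof.
move=> a0; apply: unitmx_inj => y My; apply: frob_le0.
have : frob y ((a%:M + X^T *m X) *m y) = 0 by rewrite My /frob mulmx0 mxtrace0.
rewrite mulmxDl mul_scalar_mx frobDr frobZr -mulmxA -frob_mulr => E.
rewrite -(pmulr_rle0 _ a0); have := frob_ge0 (X *m y).
by move: E; set u := a * _; set w := frob (X *m y) _; lra.
Qed.

Lemma mulmx1_invmx n (A B : 'M[R]_n) : A *m B = 1%:M -> invmx A = B.
Proof.
move=> AB; have [AU _] := mulmx1_unit AB.
by rewrite -[RHS]mul1mx -(mulVmx AU) -mulmxA AB mulmx1.
Qed.

End PositiveDefinite.

(** * The retraction as a rational map on the ambient space *)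

Section AmbientFormula.
Context {R : realType} (m n r : nat) (alpha : R).
Hypothesis alpha_gt0 : 0 < alpha.

(* At a point of the tangent bundle represented by (U, S, V) and (K, Vp), this
   is Z V^T, written without reference to the representation. *)
Definition ambient_W (z : ambient R m n * ambient R m n) : 'M[R]_n :=
  (1%:M - z.1.2) - z.1.2 *m z.2.2 +
  z.1.2 *m z.2.2 *m (z.2.1 *m (1%:M - z.1.2))^T *m z.1.1 *m
    invmx ((2 * alpha)%:M + z.1.1^T *m z.1.1) *m (1%:M - z.1.2).

(** At a represented point, [W^T W] vanishes on the range of [P]; adding [P] there makes the matrix
    invertible. *)
Definition ambient_gram (z : ambient R m n * ambient R m n) : 'M[R]_n :=
  z.1.2 + (ambient_W z)^T *m ambient_W z.

Definition ambient_retr (z : ambient R m n * ambient R m n) : ambient R m n :=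
  let Q := ambient_W z *m invmx (ambient_gram z) *m (ambient_W z)^T in
  ((z.1.1 + z.2.1) *m Q, 1%:M - Q).

Let unit_shift p q (X : 'M[R]_(p, q)) : (2 * alpha)%:M + X^T *m X \in unitmx.
Proof. by apply: unitmx_add_gram; rewrite mulr_gt0. Qed.

Section Smoothness.
Context {A : set (ambient R m n * ambient R m n)} (openA : open A) (k : nat).

Let C1 : Ck_on k A (fun z => z.1).
Proof. exact: (Ck_on_fst openA (Ck_on_id openA k)). Qed.
Let C2 : Ck_on k A (fun z => z.2).
Proof. exact: (Ck_on_snd openA (Ck_on_id openA k)). Qed.
Let CX : Ck_on k A (fun z => z.1.1).
Proof. exact: (Ck_on_fst openA C1). Qed.
Let CP : Ck_on k A (fun z => z.1.2).
Proof. exact: (Ck_on_snd openA C1). Qed.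
Let CdX : Ck_on k A (fun z => z.2.1).
Proof. exact: (Ck_on_fst openA C2). Qed.
Let CdP : Ck_on k A (fun z => z.2.2).
Proof. exact: (Ck_on_snd openA C2). Qed.

Lemma Ck_on_ambient_W : Ck_on k A ambient_W.
Proof.
have CIP : Ck_on k A (fun z => 1%:M - z.1.2).
  by apply: (Ck_onB openA) => //; exact: Ck_on_cst.
have CPdP := Ck_on_mulmx openA CP CdP.
apply: (Ck_onD openA); first exact: (Ck_onB openA).
apply: (Ck_on_mulmx openA) => //; apply: (Ck_on_mulmx openA); last first.
  apply: (Ck_on_invmx openA) => [z _|]; first exact: unit_shift.
  apply: (Ck_onD openA); first exact: Ck_on_cst.
  by apply: (Ck_on_mulmx openA) => //; exact: (Ck_on_trmx openA).
apply: (Ck_on_mulmx openA) => //; apply: (Ck_on_mulmx openA) => //.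
by apply: (Ck_on_trmx openA); exact: (Ck_on_mulmx openA).
Qed.

Lemma Ck_on_ambient_gram : Ck_on k A ambient_gram.
Proof.
have CW := Ck_on_ambient_W; apply: (Ck_onD openA) => //.
by apply: (Ck_on_mulmx openA) => //; exact: (Ck_on_trmx openA).
Qed.

Lemma Ck_on_ambient_retr : (forall z, A z -> ambient_gram z \in unitmx) ->
  Ck_on k A ambient_retr.
Proof.
move=> GU; have CW := Ck_on_ambient_W.
have CQ : Ck_on k A (fun z =>
    ambient_W z *m invmx (ambient_gram z) *m (ambient_W z)^T).
  apply: (Ck_on_mulmx openA); last exact: (Ck_on_trmx openA).
  apply: (Ck_on_mulmx openA) => //; apply: (Ck_on_invmx openA) => //.
  exact: Ck_on_ambient_gram.
apply: (Ck_on_pair openA).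
  by apply: (Ck_on_mulmx openA) => //; exact: (Ck_onD openA).
by apply: (Ck_onB openA) => //; exact: Ck_on_cst.
Qed.

End Smoothness.

Lemma open_ambient_gram_unit : open [set z | ambient_gram z \in unitmx].
Proof.
rewrite (_ : [set z | _] = (fun z => \det (ambient_gram z)) @^-1` ~` [set 0]).
  apply: open_comp; last by rewrite openC; exact: closed_eq.
  move=> z _.
  exact: (Ck_on_det openT (Ck_on_ambient_gram openT 0)).
apply/seteqP; split=> z /=; rewrite unitmxE unitfE => /eqP; exact.
Qed.

Section Representation.
Variables (x v : ambient R m n) (U : 'M[R]_(m, r)) (S : 'M[R]_r)
  (V : 'M[R]_(n, r)) (K : 'M[R]_(m, r)) (Vp : 'M[R]_(n, r)).
Hypotheses (xr : point_repr x U S V) (vr : tangent_repr v U S V K Vp).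
Let Z := retr_Z alpha U S V K Vp.
Let G := Z^T *m Z.
Let B := invsqrtmx G.

Let VV : V^T *m V = 1%:M. Proof. by case: xr. Qed.
Let VpV : Vp^T *m V = 0. Proof. by case: vr. Qed.
Let VVp : V^T *m Vp = 0.
Proof. by apply: trmx_inj; rewrite trmx_mul trmxK VpV trmx0. Qed.

Let ST : S^T = S.
Proof. by case: xr => _ _ [/diag_mxP [d ->] _ _] _ _; rewrite tr_diag_mx. Qed.

Let VZ : V^T *m Z = 1%:M.
Proof. by rewrite /Z /retr_Z mulmxDr VV mulmxA VVp mul0mx addr0. Qed.

Let GU : G \in unitmx. Proof. exact: unitmx_gram VZ. Qed.

(** Each ingredient translates separately: [P dP = - Vp V^T], [dX (1 - P) = K V^T], and [X (2 alpha
    + X^T X)^-1 = U S S(alpha)^-1 V^T]. *)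
Lemma ambient_W_repr : ambient_W (x, v) = Z *m V^T.
Proof.
have [UU _ _ xE PE] := xr; have [_ vE dPE] := vr.
rewrite /ambient_W /= PE subKr.
have PdP : (1%:M - V *m V^T) *m v.2 = - (Vp *m V^T).
  rewrite dPE mulmxBl mul1mx mulmxBr mulmxN !mulmxA.
  rewrite -(mulmxA V V^T Vp) VVp mulmx0 mul0mx oppr0 sub0r.
  by rewrite -(mulmxA V V^T V) VV mulmx1 opprK subrK.
have dXV : v.1 *m (V *m V^T) = K *m V^T.
  rewrite vE mulmxDl !mulmxA -(mulmxA K) VV mulmx1 -(mulmxA _ Vp^T) VpV.
  by rewrite mulmx0 mul0mx addr0.
(* [V^T] intertwines [2 alpha + X^T X] with [2 alpha + S^2], hence also their inverses. *)
have Vinv : V^T *m invmx ((2 * alpha)%:M + x.1^T *m x.1) =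
    invmx ((2 * alpha)%:M + S *m S) *m V^T.
  have SU : (2 * alpha)%:M + S *m S \in unitmx by rewrite -{1}ST unit_shift.
  have E : ((2 * alpha)%:M + S *m S) *m V^T =
      V^T *m ((2 * alpha)%:M + x.1^T *m x.1).
    rewrite xE !trmx_mul trmxK ST mulmxDl mulmxDr mul_scalar_mx mul_mx_scalar.
    by rewrite !mulmxA VV mul1mx -(mulmxA _ U^T) UU mulmx1.
  have XU := unit_shift x.1.
  rewrite -[LHS]mul1mx -(mulVmx SU) -!mulmxA (mulmxA _ V^T) E.
  by rewrite -(mulmxA V^T) mulmxV// mulmx1.
have xinv : x.1 *m invmx ((2 * alpha)%:M + x.1^T *m x.1) =
    U *m S *m invmx ((2 * alpha)%:M + S *m S) *m V^T.
  by rewrite {1}xE -[LHS]mulmxA Vinv !mulmxA.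
have F : Vp *m V^T *m (V *m K^T) = Vp *m K^T.
  by rewrite mulmxA -(mulmxA Vp) VV mulmx1.
rewrite PdP dXV trmx_mul trmxK opprK !mulNmx F -(mulmxA _ x.1) xinv.
rewrite /Z /retr_Z mulmxDl mulmxBr mulmx1 mulmxBl addrA !mulmxA; congr (_ - _).
by rewrite -(mulmxA _ V^T V) VV mulmx1.
Qed.

(** The Gram matrix is [P + V G V^T]. As [P] and [V V^T] are complementary projectors, it is
    inverted block by block. *)
Let gramP : ambient_gram (x, v) *m (x.2 + V *m invmx G *m V^T) = 1%:M.
Proof.
rewrite /ambient_gram ambient_W_repr /= trmx_mul trmxK.
have [_ _ _ _ PE] := xr.
have PV : x.2 *m V = 0 by rewrite PE mulmxBl mul1mx -mulmxA VV mulmx1 subrr.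
have VTP : V^T *m x.2 = 0 by rewrite PE mulmxBr mulmx1 mulmxA VV mul1mx subrr.
have PP : x.2 *m x.2 = x.2.
  by rewrite {1}PE mulmxBl mul1mx -mulmxA VTP mulmx0 subr0.
have -> : V *m Z^T *m (Z *m V^T) = V *m G *m V^T by rewrite /G !mulmxA.
move: (G) GU => G' G'U.
rewrite mulmxDl !mulmxDr PP !mulmxA PV !mul0mx addr0 -(mulmxA _ V^T) VTP.
rewrite mulmx0 add0r.
rewrite -(mulmxA _ V^T V) VV mulmx1 -(mulmxA V G') mulmxV// mulmx1.
by rewrite PE subrK.
Qed.

Lemma ambient_gram_unit : ambient_gram (x, v) \in unitmx.
Proof. by have [] := mulmx1_unit gramP. Qed.

Hypothesis rn : (r <= n)%N.

Let BT : B^T = B. Proof. by have [[]] := invsqrtmxP rn GU. Qed.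

Let BB : B *m B = invmx G. Proof. by have [] := invsqrtmxP rn GU. Qed.

(** The block [P] of the inverse disappears because [V^T P = 0]. *)
Let retr_projector :
  let W := ambient_W (x, v) in
  W *m invmx (ambient_gram (x, v)) *m W^T = Z *m invmx G *m Z^T.
Proof.
rewrite /= ambient_W_repr (mulmx1_invmx gramP) trmx_mul trmxK.
have [_ _ _ _ PE] := xr; move: (invmx G) => H.
have VTP : V^T *m x.2 = 0 by rewrite PE mulmxBr mulmx1 mulmxA VV mul1mx subrr.
rewrite mulmxDr -(mulmxA Z V^T x.2) VTP mulmx0 add0r !mulmxA.
by rewrite -(mulmxA _ V^T V) VV mulmx1 -(mulmxA _ V^T V) VV mulmx1.
Qed.

Let Q_projector : Z *m B *m (Z *m B)^T = Z *m invmx G *m Z^T.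
Proof. by rewrite trmx_mul BT mulmxA -(mulmxA Z) BB. Qed.

(** [Q] enters only through [Q *m Q^T], so the symmetric root [B] occurs only as [B *m B], the
    inverse of [G]. *)
Lemma retr_formulaE : retr_formula alpha x v U S V K Vp =
  ((x.1 + v.1) *m (Z *m invmx G *m Z^T), 1%:M - Z *m invmx G *m Z^T).
Proof. by rewrite /retr_formula -/Z -/G -/B -[in LHS]mulmxA Q_projector. Qed.

Lemma ambient_retr_repr :
  ambient_retr (x, v) = retr_formula alpha x v U S V K Vp.
Proof. by rewrite retr_formulaE /ambient_retr retr_projector. Qed.

Lemma retr_formula_desing : desing R m n r (retr_formula alpha x v U S V K Vp).
Proof.
rewrite retr_formulaE -Q_projector; set Q := Z *m B.
have QQ : Stiefel Q.
  rewrite /Stiefel /= /Q trmx_mul BT mulmxA -(mulmxA B) -/G.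
  (* [B *m (B *m G)] is the identity, and for square matrices the two factors may be exchanged. *)
  by apply: mulmx1C; rewrite mulmxA BB mulVmx.
split; first exact: Grassmann_Stiefel.
by rewrite /= -mulmxA mulmxBr mulmx1 mulmxA -(mulmxA Q) QQ mulmx1 subrr mulmx0.
Qed.

End Representation.
End AmbientFormula.

(** * Expansion of the retraction curve and normality of its acceleration *)

Section RetractionCurve.
Context {R : realType} {m n r : nat} {alpha : R}.
Hypotheses (alpha_gt0 : 0 < alpha) (rn : (r <= n)%N).
Context {x v : ambient R m n} {U : 'M[R]_(m, r)} {S : 'M[R]_r}
  {V : 'M[R]_(n, r)} {K : 'M[R]_(m, r)} {Vp : 'M[R]_(n, r)}.
Hypotheses (xr : point_repr x U S V) (vr : tangent_repr v U S V K Vp).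

Let VV : V^T *m V = 1%:M. Proof. by case: xr. Qed.
Let VpV : Vp^T *m V = 0. Proof. by case: vr. Qed.
Let VVp : V^T *m Vp = 0.
Proof. by apply: trmx_inj; rewrite trmx_mul trmxK VpV trmx0. Qed.

Lemma tangent_repr_scale t :
  tangent_repr (t *: v) U S V (t *: K) (t *: Vp).
Proof.
have [_ v1 v2] := vr.
have tT : (t *: Vp)^T = t *: Vp^T by rewrite linearZ.
split; rewrite tT; first by rewrite -scalemxAl VpV scaler0.
- by rewrite [LHS]/= v1 scalerDr -scalemxAl -scalemxAr.
- by rewrite [LHS]/= v2 scalerBr scalerN -scalemxAl -scalemxAr.
Qed.

Let M := K^T *m U *m S *m invmx ((2 * alpha)%:M + S *m S).
Let L := Vp *m M.
(** The coefficient of [t ^+ 2] in [Z (Z^T Z)^-1 Z^T], in the shape that [taylor2_mulmx]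
    produces. *)
Let Pi2 := V *m (- L)^T + Vp *m Vp^T + (V *m - (Vp^T *m Vp) - L) *m V^T.

(** Both [X *m Pi2], since [X = U S V^T], and the inner product of [Pi2] with [V Vp'^T] depend on
    [V^T Pi2] only. *)
Let VPi2 : V^T *m Pi2 = - L^T - Vp^T *m Vp *m V^T.
Proof.
have VL : V^T *m L = 0 by rewrite /L mulmxA VVp mul0mx.
have LT : (- L)^T = - L^T by rewrite linearN.
rewrite /Pi2 LT !mulmxDr (mulmxA V^T _ V^T) mulmxDr !mulmxN VL subr0 mulmxA.
by rewrite !(mulmxA V^T V) VV !mul1mx (mulmxA V^T Vp) VVp mul0mx addr0 mulNmx.
Qed.

Let c (t : R^o) := retr_formula alpha x (t *: v) U S V (t *: K) (t *: Vp).

Let curve_expansion :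
  taylor2 c x v ((K - U *m S *m M^T) *m Vp^T, - Pi2).
Proof.
have [UU _ _ x1 x2] := xr; have [_ v1 v2] := vr.
have ZT : taylor2 (fun t => retr_Z alpha U S V (t *: K) (t *: Vp)) V Vp (- L).
  exists (fun=> 0) => [k|t]; first exact: Ck_on_cst.
  have tT : (t *: K)^T = t *: K^T by rewrite linearZ.
  rewrite scaler0 addr0 /retr_Z tT -!scalemxAl -/M.
  rewrite mulmxBr mulmx1 -scalemxAr scalerBr scalerA -expr2 addrA.
  by rewrite scalerN.
have ZtT := taylor2_trmx ZT.
have GT := taylor2_mulmx ZtT ZT.
have LV : L^T *m V = 0 by rewrite /L trmx_mul -mulmxA VpV mulmx0.
have VL : V^T *m L = 0 by rewrite /L mulmxA VVp mul0mx.
(* [V^T] is a left inverse of [Z] for every [t], which gives the global invertibility required by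
   [taylor2_invmx]. *)
have GU t : (retr_Z alpha U S V (t *: K) (t *: Vp))^T *m
    retr_Z alpha U S V (t *: K) (t *: Vp) \in unitmx.
  apply: (@unitmx_gram _ _ _ V^T).
  by rewrite mulmxDr VV mulmxA -scalemxAr VVp scaler0 mul0mx addr0.
(* The orthogonality relations leave the coefficients [1%:M], 0 and [Vp^T *m Vp] for [Z^T Z]. *)
rewrite VV VVp VpV addr0 mulmxN VL oppr0 add0r in GT.
rewrite linearN /= mulNmx LV oppr0 addr0 in GT.
have GiT := taylor2_invmx GU GT.
have PiT := taylor2_mulmx (taylor2_mulmx ZT GiT) ZtT.
rewrite !mulmx0 !mulmx1 !addr0 !add0r in PiT.
have XT := taylor2D (taylor2_cst x.1) (taylor2_scale v.1).
rewrite addr0 add0r addr0 in XT.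
have X1T := taylor2_mulmx XT PiT.
have P1T := taylor2D (taylor2_cst (1%:M : 'M[R]_n)) (taylor2N PiT).
have := taylor2_pair X1T P1T.
have x1Pi1 : x.1 *m (V *m Vp^T + Vp *m V^T) = U *m S *m Vp^T.
  rewrite x1 mulmxDr !mulmxA -(mulmxA _ V^T V) VV mulmx1.
  by rewrite -(mulmxA _ V^T Vp) VVp mulmx0 mul0mx addr0.
rewrite -/Pi2 x1Pi1 mul0mx addr0 !sub0r.
congr taylor2.
- apply/funext => t.
  by rewrite /c (retr_formulaE alpha xr (tangent_repr_scale t) rn).
- rewrite -x2 [x.1 in LHS]x1 mulmxA -(mulmxA _ V^T V) VV mulmx1 -x1.
  by case: (x).
- rewrite v1 mulmxDl !mulmxA -(mulmxA K) VV mulmx1 -(mulmxA _ Vp^T V) VpV.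
  rewrite mulmx0 mul0mx addr0 opprD [in X in (_, X)]addrC [in X in (X, _)]addrC.
  by rewrite -v1 -v2; case: (v).
(* The term [b] occurs with opposite signs in the contributions of [x.1] and [v.1], and cancels. *)
- congr (_, _); set b := U *m S *m (Vp^T *m Vp *m V^T).
  have -> : x.1 *m Pi2 = - (U *m S *m M^T *m Vp^T) - b.
    rewrite x1 -(mulmxA _ V^T Pi2) VPi2 mulmxBr mulmxN [L^T]trmx_mul.
    by rewrite /b !mulmxA.
  have -> : v.1 *m (V *m Vp^T + Vp *m V^T) = K *m Vp^T + b.
    rewrite v1 mulmxDl !mulmxDr !mulmxA -(mulmxA K V^T V) VV mulmx1.
    rewrite -(mulmxA K V^T Vp) VVp mulmx0 mul0mx addr0.
    by rewrite -(mulmxA _ Vp^T V) VpV mulmx0 mul0mx add0r /b !mulmxA.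
  by rewrite mulmxBl [LHS]addrC -addrA [X in _ + X]addrCA subrr addr0.
Qed.

Lemma retraction_acceleration_normal (u : ambient R m n)
    (K' : 'M[R]_(m, r)) (Vp' : 'M[R]_(n, r)) :
  tangent_repr u U S V K' Vp' ->
  ambient_ip R m n alpha ((K - U *m S *m M^T) *m Vp^T, - Pi2) u = 0.
Proof.
move=> [Vp'V u1 u2]; have [UU _ [Sd _ _] _ _] := xr.
have ST : S^T = S by have /diag_mxP [d ->] := Sd; rewrite tr_diag_mx.
have frobT p q (A B : 'M[R]_(p, q)) : frob A^T B^T = frob A B.
  by rewrite /frob trmxK -mxtrace_tr trmx_mul trmxK mxtrace_mulC.
have SU : (2 * alpha)%:M + S *m S \in unitmx.
  by rewrite -{1}ST unitmx_add_gram// mulr_gt0.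
(* This is where the choice of [M] acts: [K^T U S - M S^2 = 2 alpha M], since
   [M (2 alpha + S^2) = K^T U S]. *)
have ME : (K - U *m S *m M^T)^T *m (U *m S) = (2 * alpha) *: M.
  have -> : (K - U *m S *m M^T)^T = K^T - M *m S *m U^T.
    by rewrite linearB /= [X in _ - X]trmx_mul trmxK trmx_mul ST mulmxA.
  have MS : M *m ((2 * alpha)%:M + S *m S) = K^T *m U *m S.
    by rewrite /M mulmxKV.
  rewrite mulmxBl !mulmxA -(mulmxA _ U^T U) UU mulmx1 -MS mulmxDr mul_mx_scalar.
  by rewrite mulmxA addrK.
have Pi2T : Pi2^T = Pi2.
  have LT : (- L)^T = - L^T by rewrite linearN.
  have NT : (- (Vp^T *m Vp))^T = - (Vp^T *m Vp).
    by rewrite linearN /= trmx_mul trmxK.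
  have PT : (V *m - (Vp^T *m Vp) - L)^T = - (Vp^T *m Vp) *m V^T - L^T.
    by rewrite linearB /= trmx_mul NT.
  rewrite /Pi2 [LHS]linearD /= [X in X + _]linearD /= !trmx_mul PT LT.
  rewrite linearN /= !trmxK mulmxBr mulmxBl mulNmx mulmxN.
  by rewrite [LHS]addrC [LHS]addrACA [LHS]addrC (mulmxA V).
set D := K - U *m S *m M^T in ME *.
pose tau := \tr (M *m (Vp'^T *m Vp)).
have f1 : frob (D *m Vp^T) u.1 = (2 * alpha) * tau.
  rewrite u1 frobDr /frob trmx_mul trmxK -!mulmxA !(mxtrace_mulC Vp) -!mulmxA.
  rewrite VVp !mulmx0 mxtrace0 add0r !mulmxA -(mulmxA D^T U S) ME.
  by rewrite -!scalemxAl mxtraceZ /tau mulmxA.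
have f2 : frob Pi2 (V *m Vp'^T) = - tau.
  have VVp' : V^T *m Vp' = 0.
    by apply: trmx_inj; rewrite trmx_mul trmxK Vp'V trmx0.
  rewrite frobC frob_mulr VPi2 frobDr !frobNr /frob trmxK.
  rewrite (mulmxA Vp' _ V^T) (mxtrace_mulC _ V^T) (mulmxA V^T Vp') VVp'.
  rewrite mul0mx mxtrace0 subr0.
  rewrite -mxtrace_tr trmx_mul trmxK /L -(mulmxA Vp) mxtrace_mulC.
  by rewrite /tau mulmxA.
have f3 : frob Pi2 (Vp' *m V^T) = - tau.
  by rewrite -frobT Pi2T trmx_mul trmxK f2.
(* The first component contributes [2 * alpha * tau]; the two halves of the second contribute
   [- alpha * tau] each. *)
rewrite /ambient_ip f1 [u.2]/= u2 frobNl frobDr !frobNr f2 f3; ring.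
Qed.

Lemma retraction_curve_derivatives :
  let c := fun t : R^o =>
    retr_formula alpha x (t *: v) U S V (t *: K) (t *: Vp) in
  [/\ c 0 = x, is_derive (0 : R^o) 1 c v &
    exists2 a, is_derive (0 : R^o) 1 (derive1 c) a &
      forall u K' Vp', tangent_repr u U S V K' Vp' ->
        ambient_ip R m n alpha a u = 0].
Proof.
have [E EC /funext cE] := curve_expansion.
have := curve_taylor2 x v ((K - U *m S *m M^T) *m Vp^T, - Pi2) (EC 2%N).
rewrite -/c cE => -[c0 c1 c2]; split=> //.
eexists; first exact: c2.
(* The acceleration is twice the second-order coefficient, so it is normal as well. *)
move=> u K' Vp' /retraction_acceleration_normal.
by rewrite mulr2n /ambient_ip /= !frobDl; lra.
Qed.

End RetractionCurve.

(** * The second-order retraction on the desingularization *)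

Section DesingRetr.
Context {R : realType} {m n r : nat} {alpha : R}.
Hypotheses (alpha_gt0 : 0 < alpha) (r_lt : (r < minn m n)%N).

Let rn : (r <= n)%N.
Proof. by move: r_lt; rewrite leq_min => /andP[_ /ltnW]. Qed.

(** The formula at any representation equals [ambient_retr] at [(x, v)], so the representation
    behind the value picked by [xget] does not matter. *)
Lemma desing_retrE (x v : ambient R m n) (U : 'M[R]_(m, r)) (S : 'M[R]_r)
    (V : 'M[R]_(n, r)) (K : 'M[R]_(m, r)) (Vp : 'M[R]_(n, r)) :
  point_repr x U S V -> tangent_repr v U S V K Vp ->
  desing_retr R m n r alpha (x, v) = retr_formula alpha x v U S V K Vp.
Proof.
move=> xr vr; rewrite -(ambient_retr_repr alpha_gt0 xr vr rn) /desing_retr.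
set D := [set y | _].
have [|U' [S' [V' [K' [Vp' [xr' vr' ->]]]]]] := @xgetPex _ x D.
  by exists (retr_formula alpha x v U S V K Vp), U, S, V, K, Vp.
by rewrite -(ambient_retr_repr alpha_gt0 xr' vr' rn).
Qed.

Lemma tangent_bundle_repr (x v : ambient R m n) :
  tangent_bundle (desing R m n r) (x, v) -> exists U S V K Vp,
    point_repr x U S V /\
    tangent_repr (r := r) v U S V K Vp.
Proof.
move=> [/= xM vT]; have [U [S [V xr]]] := point_repr_exists r_lt xM.
have [K [Vp vr]] := tangent_repr_exists xr (desing_tangent_eqs vT).
by exists U, S, V, K, Vp.
Qed.

Lemma desing_retr_smooth : smooth_map (tangent_bundle (desing R m n r))
  (desing R m n r) (desing_retr R m n r alpha).
Proof.
split=> [[x v] /tangent_bundle_repr|[x v] /tangent_bundle_repr].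
  move=> [U [S [V [K [Vp [xr vr]]]]]]; rewrite (desing_retrE xr vr).
  exact: (retr_formula_desing alpha xr vr rn).
move=> [U [S [V [K [Vp [xr vr]]]]]].
exists [set z | ambient_gram alpha z \in unitmx], (ambient_retr alpha).
have oU := @open_ambient_gram_unit R m n alpha alpha_gt0.
split=> //.
- exact: (ambient_gram_unit alpha_gt0 xr vr).
- by move=> k; exact: (Ck_on_ambient_retr alpha_gt0 oU).
- move=> [y w] /tangent_bundle_repr [U' [S' [V' [K' [Vp' [yr wr]]]]]] _.
  by rewrite (desing_retrE yr wr) (ambient_retr_repr alpha_gt0 yr wr rn).
Qed.

(** For 0 to be the projection of the acceleration it must itself be tangent; a constant curve shows
    this. *)
Lemma tangent_space0 (A : set (ambient R m n)) x : A x -> tangent_space A x 0.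
Proof.
move=> Ax; exists 1, (fun=> x); split=> //; first by move=> k; exact: Ck_on_cst.
exact: is_derive_cst.
Qed.

Lemma desing_retr_second_order :
  second_order_retraction (ambient_ip R m n alpha) (desing R m n r)
    (desing_retr R m n r alpha).
Proof.
(* One triplet for [x] serves for all [t], with the pair scaled by [t]; this replaces the choice
   made at each [t] by a single formula. *)
have curveE x v U S V K Vp : point_repr x U S V ->
    tangent_repr (r := r) v U S V K Vp ->
    (fun t : R^o => desing_retr R m n r alpha (x, t *: v)) =
    (fun t : R^o => retr_formula alpha x (t *: v) U S V (t *: K) (t *: Vp)).
  move=> xr vr; apply/funext => t; apply: desing_retrE => //.
  exact: (tangent_repr_scale vr).
have retrR : retraction (desing R m n r) (desing_retr R m n r alpha).
  split; first exact: desing_retr_smooth.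
  move=> x v /tangent_bundle_repr [U [S [V [K [Vp [xr vr]]]]]] c.
  have cE : c = _ := curveE _ _ _ _ _ _ _ xr vr; rewrite cE.
  by have [c0 c1 _] := retraction_curve_derivatives alpha_gt0 rn xr vr.
split=> // x v xv; have [U [S [V [K [Vp [xr vr]]]]]] := tangent_bundle_repr xv.
have [_ _ [a ca aN]] := retraction_curve_derivatives alpha_gt0 rn xr vr.
have [c0 _] := retrR.2 x v xv.
rewrite /intrinsic_acceleration.
rewrite [X in tangent_space _ X](_ : _ = x); last exact: c0.
rewrite (curveE _ _ _ _ _ _ _ xr vr).
exists a; split=> //; split; first by apply: tangent_space0; case: xv.
move=> u uT; rewrite subr0.
(* An arbitrary tangent vector is represented with the same triplet as [x], as the normality
   statement demands. *)
have [K' [Vp' ur]] := tangent_repr_exists xr (desing_tangent_eqs uT).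
exact: aN ur.
Qed.

End DesingRetr.

Theorem proposition3p12 (R : realType) (m n r : nat) (alpha : R)
  (r_gt0 : (0 < r)%N) (r_lt : (r < minn m n)%N) (alpha_gt0 : 0 < alpha) :
  (forall (x v : ambient R m n),
      desing R m n r x -> tangent_space (desing R m n r) x v ->
      forall (U : 'M[R]_(m, r)) (S : 'M[R]_r) (V : 'M[R]_(n, r))
             (K : 'M[R]_(m, r)) (Vp : 'M[R]_(n, r)),
        point_repr x U S V -> tangent_repr v U S V K Vp ->
        desing_retr R m n r alpha (x, v) = retr_formula alpha x v U S V K Vp) /\
  second_order_retraction (ambient_ip R m n alpha) (desing R m n r)
    (desing_retr R m n r alpha).
Proof.
split; last exact: desing_retr_second_order.
move=> x v _ _ U S V K Vp; exact: desing_retrE.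
Qed.
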